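(* Let $\Omega\subset\mathbb{R}^d$ be a non-empty, bounded, open set and let $\Phi\colon\mathbb{R}^N_+\to[0,\infty)$ satisfy (Φ.1), (Φ.2) and (Φ.3). Then there exists a $(1,\Phi)$-eigen-$N$-function of $\Omega$.
   Context: $BV_0(F)=\{u\in BV(\mathbb{R}^d): u=0 \text{ a.e. on } \mathbb{R}^d\setminus F\}$; $|Du|(\mathbb{R}^d)$ is the total variation. A $(1,N)$-function of $F$ is $u=(u_1,\dots,u_N)$ with $u_i\in BV_0(F)$, $u_i\ge0$, $\|u_i\|_{L^1}=1$, and $u_iu_j=0$ a.e. for $i\ne j$; set $[u]_1=(|Du_1|(\mathbb{R}^d),\dots,|Du_N|(\mathbb{R}^d))$. $\Lambda^{\Phi,N}_{1,1}(F)=\inf\{\Phi([u]_1): u \text{ a } (1,N)\text{-function of } F\}$; a minimizer is a $(1,\Phi)$-eigen-$N$-function of $F$. $\mathbb{R}^N_+=\{v:v_i\ge0\}$ with componentwise order. (Φ.1): $\Phi$ lower semicontinuous. (Φ.2): $\exists\delta>0$ with $\Phi(v)\ge\delta\sum_iv_i$. (Φ.3): $v\le w\Rightarrow\Phi(v)\le\Phi(w)$. *)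

(* Defs.v *)
From HB Require Import structures.
From mathcomp Require Import all_boot all_order all_algebra.
From mathcomp Require Import all_classical all_reals all_analysis.
Set Implicit Arguments. Unset Strict Implicit. Unset Printing Implicit Defensive.
Import Order.TTheory GRing.Theory Num.Theory.
Import numFieldNormedType.Exports.
Local Open Scope classical_set_scope.
Local Open Scope ring_scope.

(* Borel sigma-algebra on R^d = 'rV[R]_d : generated by the coordinates *)
Definition measure_rV_display : measure_display -> measure_display.
Proof. exact. Qed.

Section measurable_rV.
Context {R : realType} (n : nat).

Definition rV_coord : 'I_n -> 'rV[R]_n -> R := fun i x => x ord0 i.

Let rV_set0 : g_sigma_preimage rV_coord set0.
Proof. exact: sigma_algebra0. Qed.
Let rV_setC A : g_sigma_preimage rV_coord A -> g_sigma_preimage rV_coord (~` A).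
Proof. exact: sigma_algebraC. Qed.
Let rV_bigcup (F : _^nat) : (forall i, g_sigma_preimage rV_coord (F i)) ->
  g_sigma_preimage rV_coord (\bigcup_i (F i)).
Proof. exact: sigma_algebra_bigcup. Qed.

HB.instance Definition _ := @isMeasurable.Build
  (measure_rV_display default_measure_display)
  'rV[R]_n (g_sigma_preimage rV_coord) rV_set0 rV_setC rV_bigcup.
End measurable_rV.

Definition rV_cons {R : realType} (d : nat) (p : R * 'rV[R]_d) : 'rV[R]_d.+1 :=
  row_mx (\row_(_ < 1) p.1) p.2.

Fixpoint lebesgue_Rd {R : realType} (d : nat) : set 'rV[R]_d -> \bar R :=
  match d with
  | 0 => fun A => \d_(0 : 'rV[R]_0) A
  | d'.+1 => fun A =>
      ((@lebesgue_measure R) \x (@lebesgue_Rd R d'))%E (@rV_cons R d' @^-1` A)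
  end.

Section BV.
Context {R : realType} (d : nat).
Local Notation Rd := 'rV[R]_d.
Local Notation leb := (@lebesgue_Rd R d).

Definition basis_vec (i : 'I_d) : Rd := delta_mx ord0 i.

Definition L1 (u : Rd -> R) : Prop :=
  measurable_fun setT u /\ (\int[leb]_x (`|u x|)%:E < +oo)%E.

Definition test_field (phi : Rd -> Rd) : Prop :=
  [/\ forall (i j : 'I_d) x,
        derivable (fun y => phi y ord0 j) x (basis_vec i),
      forall (i j : 'I_d),
        continuous (fun x => 'D_(basis_vec i) (fun y => phi y ord0 j) x),
      compact (closure [set x | phi x != 0])
    & forall x, \sum_(j < d) (phi x ord0 j) ^+ 2 <= 1].

Definition divergence (phi : Rd -> Rd) (x : Rd) : R :=
  \sum_(i < d) 'D_(basis_vec i) (fun y => phi y ord0 i) x.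

Definition total_variation (u : Rd -> R) : \bar R :=
  ereal_sup [set (\int[leb]_x (u x * divergence phi x)%:E)%E
            | phi in test_field].

Definition BV (u : Rd -> R) : Prop := L1 u /\ (total_variation u < +oo)%E.

Definition BV0 (F : set Rd) (u : Rd -> R) : Prop :=
  BV u /\ {ae leb, forall x, ~ F x -> u x = 0}.

Definition oneN_function (N : nat) (F : set Rd) (u : 'I_N -> Rd -> R) : Prop :=
  [/\ forall i, BV0 F (u i),
      forall i, {ae leb, forall x, 0 <= u i x},
      forall i, (\int[leb]_x (`|u i x|)%:E = 1)%E
    & forall i j, i != j -> {ae leb, forall x, u i x * u j x = 0}].

Definition bracket1 (N : nat) (u : 'I_N -> Rd -> R) : 'rV[R]_N :=
  \row_(i < N) fine (total_variation (u i)).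

Definition Lambda (N : nat) (Phi : 'rV[R]_N -> R) (F : set Rd) : \bar R :=
  ereal_inf [set (Phi (bracket1 u))%:E | u in [set u : 'I_N -> Rd -> R | oneN_function F u]].

Definition eigen_N_function (N : nat) (Phi : 'rV[R]_N -> R) (F : set Rd)
    (u : 'I_N -> Rd -> R) : Prop :=
  oneN_function F u /\ (Phi (bracket1 u))%:E = Lambda Phi F.
End BV.

Section Phi.
Context {R : realType} (N : nat).

Definition nonneg_vec (v : 'rV[R]_N) : Prop := forall i, 0 <= v ord0 i.

Definition Phi_codomain (Phi : 'rV[R]_N -> R) : Prop :=
  forall v, nonneg_vec v -> 0 <= Phi v.

Definition Phi1 (Phi : 'rV[R]_N -> R) : Prop :=
  forall v, nonneg_vec v -> forall a, a < Phi v ->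
    exists2 V, nbhs v V & forall w, V w -> nonneg_vec w -> a < Phi w.

Definition Phi2 (Phi : 'rV[R]_N -> R) : Prop :=
  exists2 delta : R, 0 < delta &
    forall v, nonneg_vec v -> delta * \sum_(i < N) v ord0 i <= Phi v.

Definition Phi3 (Phi : 'rV[R]_N -> R) : Prop :=
  forall v w, nonneg_vec v -> nonneg_vec w ->
    (forall i, v ord0 i <= w ord0 i) -> Phi v <= Phi w.
End Phi.

(* Main.v *)
Require Import Defs.
From HB Require Import structures.
From mathcomp Require Import all_boot all_order all_algebra.
From mathcomp Require Import all_classical all_reals all_analysis.
From mathcomp Require Import measurable_realfun ring lra.
Set Implicit Arguments. Unset Strict Implicit. Unset Printing Implicit Defensive.
Import Order.TTheory GRing.Theory Num.Theory.
Import numFieldNormedType.Exports Defs.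
Local Open Scope classical_set_scope.
Local Open Scope ring_scope.

(** Direct method. A total variation bound controls translations in L^1: for a
    C^1 test function psi with |psi| <= 1, the derivative of
    t |-> int u(x) psi(x + t e_i) dx is int u div(psi(. + t e_i) e_i), hence bounded
    by |Du|, and duality gives ||u(. + z) - u||_1 <= |Du| (|z_1| + ... + |z_d|).
    Averages of u over small cubes are then close to u in L^1 and equi-Lipschitz,
    so a minimizing sequence supported in a bounded set has an L^1 and a.e.
    convergent subsequence. All the constraints pass to the limit, the total
    variation is lower semicontinuous, and (Phi.1), (Phi.3) conclude. A competitor
    with finite energy is made of disjoint tents, whose total variation is finite
    by the converse estimate: a Lipschitz bound on translations in L^1 bounds |Du|. *)

(** * Lebesgue measure on R^d *)

(** The constraint [u_i u_j = 0] is nonlinear and can be lost under weak convergence, so a.e.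
    convergence is required. The subsequence is therefore chosen at distance at most [2^-(k+1)] from
    its limit in L^1, the same subsequence for all [N] components: summability of the rate gives
    a.e. convergence, and the L^1 convergence keeps the masses equal to 1 and makes each
    [int u div(phi)] converge. The bound on the total variations along a minimizing sequence comes
    from (Phi.2). Test fields are used one axis at a time. This costs factors [d] in the estimates,
    which is harmless: compactness needs a uniform bound and the competitors need only finite total
    variation. Since [lebesgue_Rd] is a set function defined by recursion on the dimension, even its
    being a measure, the size of cubes and translation invariance have to be derived by
    induction. *)

Section rV_measurable.
Context {R : realType}.

Lemma measurable_rV_coord n (i : 'I_n) :
  measurable_fun [set: 'rV[R]_n] (fun x => x ord0 i).
Proof.
move=> _ Y mY; rewrite setTI; apply: sub_sigma_algebra => /=.
rewrite -bigcup_seq/=; exists i => /=; first by rewrite mem_index_enum.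
by exists Y => //; rewrite setTI.
Qed.

Lemma measurable_rVP d (T : measurableType d) n (f : T -> 'rV[R]_n) :
  (forall i, measurable_fun [set: T] (fun x => f x ord0 i)) ->
  measurable_fun [set: T] f.
Proof.
move=> mf _ A mA; rewrite setTI.
suff : g_sigma_preimage (@rV_coord R n) `<=` [set B | measurable (f @^-1` B)].
  exact.
apply: smallest_sub.
  split => /=; first by rewrite preimage_set0.
  - by move=> B mB; rewrite setTD; exact: measurableC.
  - by move=> F mF; rewrite preimage_bigcup; exact: bigcup_measurable.
rewrite -bigcup_seq/= => B [i _] [C mC <-] /=.
have := mf i measurableT C mC.
by rewrite !setTI.
Qed.

Lemma rV_cons0 d (p : R * 'rV[R]_d) : rV_cons p ord0 ord0 = p.1.
Proof.
rewrite /rV_cons.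
have -> : (ord0 : 'I_d.+1) = lshift d (ord0 : 'I_1) by exact: val_inj.
by apply: etrans (row_mxEl _ _ _ _) _; rewrite mxE.
Qed.

Lemma rV_consS d (p : R * 'rV[R]_d) (i : 'I_d) :
  rV_cons p ord0 (lift ord0 i) = p.2 ord0 i.
Proof.
rewrite /rV_cons.
have -> : lift (ord0 : 'I_d.+1) i = rshift 1 i by exact: val_inj.
exact: row_mxEr.
Qed.

Lemma measurable_rV_cons d :
  measurable_fun [set: measurableTypeR R * 'rV[R]_d] (@rV_cons R d).
Proof.
apply: measurable_rVP => i; have [j ->|->] := unliftP ord0 i.
- rewrite (_ : (fun _ => _) = (fun x : 'rV[R]_d => x ord0 (j : 'I_d)) \o snd).
    apply: measurableT_comp; last exact: measurable_snd.
    exact: measurable_rV_coord.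
  by apply/funext => p; rewrite rV_consS.
- rewrite (_ : (fun _ => _) = fst); first exact: measurable_fst.
  by apply/funext => p; rewrite rV_cons0.
Qed.

End rV_measurable.

(** Written in coordinates so that it splits as a product along [rV_cons]; for positive radius it is
    the ball of the sup norm. *)
Definition cube {R : realType} d (x : 'rV[R]_d) (r : R) : set 'rV[R]_d :=
  [set y | forall i, `|y ord0 i - x ord0 i| < r].

Lemma ler_coord_norm {R : realType} d (x : 'rV[R]_d) (i : 'I_d) :
  `|x ord0 i| <= `|x|.
Proof.
rewrite [leRHS]/Num.Def.normr/= mx_normrE.
exact: (le_bigmax _ (fun ij : 'I_1 * 'I_d => `|x ij.1 ij.2|) (ord0, i)).
Qed.

Lemma ball_cube {R : realType} d (x : 'rV[R]_d) (r : R) :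
  0 < r -> ball x r = cube x r.
Proof.
move=> r0; apply/seteqP; split => y /=.
  by move=> [_ h] i; rewrite distrC; exact: h.
by move=> h; split => // k i; rewrite !ord1 /ball/= distrC; exact: h.
Qed.

(** Inside an induction on the dimension sigma-finiteness is available only as a proposition; this
    turns it into the bundled structure expected by product measures. *)
Lemma sigma_finite_measure_pack d (T : measurableType d) (R : realType)
    (mu : {measure set T -> \bar R}) : sigma_finite setT mu ->
  exists nu : {sigma_finite_measure set T -> \bar R}, nu = mu :> (set T -> \bar R).
Proof.
move=> sf.
pose M1 := isSFinite.Build d T R mu (sfinite_measure_sigma_finite sf).
pose M2 := isSigmaFinite.Build d T R mu sf.
by exists (HB.pack_for {sigma_finite_measure set T -> \bar R}
  (Measure.sort mu) mu M1 M2).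
Qed.

Section lebesgue_Rd_measure.
Context {R : realType}.

Lemma measurable_cube d (x : 'rV[R]_d) r : measurable (cube x r).
Proof.
rewrite (_ : cube x r = \bigcap_(i in [set: 'I_d])
   ((fun y : 'rV[R]_d => y ord0 i) @^-1` (ball (x ord0 i) r))).
  apply: fin_bigcap_measurable; first exact: finite_finset.
  move=> i _; rewrite -[X in measurable X]setTI.
  by apply: measurable_rV_coord => //; exact: measurable_ball.
apply/seteqP; split => y /= h i; first by move=> _ /=; rewrite /ball/= distrC.
by have := h i I; rewrite /= /ball/= distrC.
Qed.

(* [lebesgue_Rd] is a bare set function defined by recursion on [d]; at each step
   the product measure requires a sigma-finite measure structure on the previous one. *)
Definition measure_like d (m : set 'rV[R]_d -> \bar R) :=
  exists2 mu : {sigma_finite_measure set 'rV[R]_d -> \bar R},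
    m = mu & forall x r, 0 < r -> (0 < mu (cube x r) < +oo)%E.

(** Finiteness of cubes is carried along because it proves sigma-finiteness at the next dimension,
    by exhaustion with cubes of integer size. Positivity is needed later, to divide by volumes of
    cubes and to normalize the tents. *)
Lemma lebesgue_Rd_measure_like d : measure_like (@lebesgue_Rd R d).
Proof.
elim: d => [|d [mu ihE ihc]] /=.
  exists (\d_(0 : 'rV[R]_0)) => // x r r0.
  rewrite /= diracE mem_set/= ?lte01 ?ltry//.
  by move=> -[].
rewrite ihE.
pose m := pushforward (@lebesgue_measure R \x mu)%E (@rV_cons R d).
have mc := @measurable_rV_cons R d.
pose mm : {measure set 'rV[R]_d.+1 -> \bar R} :=
  measure_function_pushforward__canonical__measure_function_Measure
    (@lebesgue_measure R \x mu)%E mc.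
have mcube x r : 0 < r -> (0 < mm (cube x r) < +oo)%E.
  move=> r0.
  have -> : mm (cube x r) = (lebesgue_measure (ball (x ord0 ord0) r) *
      mu (cube (\row_i x ord0 (lift ord0 i)) r))%E.
    rewrite /mm/= /m /pushforward -product_measure1E//; first last.
    - exact: measurable_cube.
    - exact: measurable_ball.
    congr (_ _); apply/seteqP; split => -[a b] /= h.
    + split; first by have := h ord0; rewrite rV_cons0 /= /ball/= distrC.
      by move=> i; have := h (lift ord0 i); rewrite rV_consS mxE.
    + case: h => h1 h2 i; have [j ->|->] := unliftP ord0 i.
        by have := h2 j; rewrite rV_consS mxE.
      by rewrite rV_cons0; move: h1; rewrite /ball/= distrC.
  have /andP[h1 h2] := ihc (\row_i x ord0 (lift ord0 i)) r r0.
  rewrite lebesgue_measure_ball ?ltW//; apply/andP; split.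
    by apply: mule_gt0 => //; rewrite lte_fin mulrn_wgt0.
  by apply: lte_mul_pinfty => //; rewrite lee_fin mulrn_wge0 ?ltW.
have sf : sigma_finite setT mm.
  exists (fun n => cube 0 n.+1%:R).
    apply/seteqP; split => // y _.
    exists (Num.truncn `|y|) => //= i.
    rewrite mxE subr0; apply: le_lt_trans (truncnS_gt _).
    exact: ler_coord_norm.
  move=> n; split; first exact: measurable_cube.
  by have /andP[] := mcube 0 n.+1%:R (ltr0Sn _ _).
have [nu nuE] := sigma_finite_measure_pack sf.
exists nu; first by rewrite nuE.
by move=> x r r0; rewrite nuE; exact: mcube.
Qed.
End lebesgue_Rd_measure.

Section lebesgue_Rd_instance.
Context {R : realType} (d : nat).
Local Notation leb := (@lebesgue_Rd R d).

Let leb0 : leb set0 = 0%E.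
Proof. by have [mu muE _] := @lebesgue_Rd_measure_like R d; rewrite muE; exact: measure0. Qed.

Let leb_ge0 A : (0 <= leb A)%E.
Proof. by have [mu muE _] := @lebesgue_Rd_measure_like R d; rewrite muE; exact: measure_ge0. Qed.

Let leb_sigma_additive : semi_sigma_additive leb.
Proof.
by have [mu muE _] := @lebesgue_Rd_measure_like R d; rewrite muE; exact: measure_semi_sigma_additive.
Qed.

HB.instance Definition _ := isMeasure.Build _ _ _ leb
  leb0 leb_ge0 leb_sigma_additive.

Let leb_sigma_finite : sigma_finite setT leb.
Proof.
by have [mu muE _] := @lebesgue_Rd_measure_like R d; rewrite muE; exact: sigma_finiteT.
Qed.

HB.instance Definition _ := Measure_isSigmaFinite.Build _ _ _ leb leb_sigma_finite.

Lemma lebesgue_Rd_cube_gt0 (x : 'rV[R]_d) r : 0 < r -> (0 < leb (cube x r))%E.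
Proof.
move=> r0; have [mu muE] := @lebesgue_Rd_measure_like R d.
by rewrite muE => /(_ x _ r0)/andP[].
Qed.

Lemma lebesgue_Rd_cube_lty (x : 'rV[R]_d) r : 0 < r -> (leb (cube x r) < +oo)%E.
Proof.
move=> r0; have [mu muE] := @lebesgue_Rd_measure_like R d.
by rewrite muE => /(_ x _ r0)/andP[].
Qed.

Lemma measurable_addr_rV (z : 'rV[R]_d) :
  measurable_fun [set: 'rV[R]_d] (fun x => x + z).
Proof.
apply: measurable_rVP => i.
rewrite (_ : (fun _ => _) = (fun x : 'rV[R]_d => x ord0 i + z ord0 i)).
  by apply: measurable_funD => //; exact: measurable_rV_coord.
by apply/funext => x; rewrite mxE.
Qed.

End lebesgue_Rd_instance.

(** * Translation invariance *)

Section translation.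
Context {R : realType}.

(** The translated measure agrees with Lebesgue measure on half-open intervals, and these determine
    it. *)
Lemma lebesgue_measure_translate (z : R) (A : set (measurableTypeR R)) :
  measurable A ->
  pushforward lebesgue_measure (fun x : measurableTypeR R => x + z : measurableTypeR R) A
  = lebesgue_measure A.
Proof.
move=> mA.
have mz : measurable_fun [set: measurableTypeR R]
    (fun x : measurableTypeR R => x + z : measurableTypeR R).
  exact: measurable_funD.
apply/esym/(@lebesgue_measure_unique R
  (measure_function_pushforward__canonical__measure_function_Measure
    (@lebesgue_measure R) mz)) => //= _ [[a b]] _ <-.
rewrite /pushforward (_ : _ @^-1` _ = `](a - z), (b - z)]%classic); last first.
  by apply/seteqP; split => x /=; rewrite !in_itv/= ltrBlDr lerBrDr.
rewrite !lebesgue_measure_itv/= !lte_fin ltrD2r.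
by case: ifP => // _; rewrite -!EFinD; congr EFin; ring.
Qed.

Lemma rV_consD d (x a : R) (y b : 'rV[R]_d) :
  rV_cons (x, y) + rV_cons (a, b) = rV_cons (x + a, y + b).
Proof.
by apply/rowP => i; rewrite mxE; have [j ->|->] := unliftP ord0 i;
  rewrite ?rV_cons0 ?rV_consS ?mxE.
Qed.

Lemma rV_cons_ex d (z : 'rV[R]_d.+1) : exists a b, z = rV_cons (a, b).
Proof.
exists (z ord0 ord0), (\row_i z ord0 (lift ord0 i)).
by apply/rowP => i; have [j ->|->] := unliftP ord0 i;
  rewrite ?rV_cons0 ?rV_consS ?mxE.
Qed.

Lemma lebesgue_Rd_translate d (z : 'rV[R]_d) (A : set 'rV[R]_d) : measurable A ->
  lebesgue_Rd ((fun x => x + z) @^-1` A) = lebesgue_Rd A.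
Proof.
elim: d z A => [|d ih] z A mA.
  congr lebesgue_Rd; apply/seteqP; split => x /=;
  by rewrite (_ : x + z = x)//; apply/rowP => -[].
have [a [b ->]] := rV_cons_ex z.
have mA' : measurable (@rV_cons R d @^-1` A).
  by rewrite -[X in measurable X]setTI; exact: measurable_rV_cons.
rewrite /= /product_measure1.
pose F x := lebesgue_Rd (xsection (@rV_cons R d @^-1` A) x).
have mF : measurable_fun [set: measurableTypeR R] F.
  exact: measurable_fun_xsection.
(* The induction hypothesis translates each section by [b]; what remains is a translation by [a] of
   the first coordinate. *)
transitivity (\int[@lebesgue_measure R]_x F ((x : R) + a)%R)%E.
  apply: eq_integral => x _; rewrite /F/=.
  rewrite -(ih b (xsection (@rV_cons R d @^-1` A) (x + a))); last exact: measurable_xsection.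
  congr lebesgue_Rd; apply/seteqP; split => y /=.
  - by rewrite /xsection /= !inE /= rV_consD.
  - by rewrite /xsection /= !inE /= rV_consD.
have mz : measurable_fun [set: measurableTypeR R]
    (fun x : measurableTypeR R => x + a : measurableTypeR R).
  exact: measurable_funD.
have := ge0_integral_pushforward mz (@lebesgue_measure R) measurableT mF.
rewrite preimage_setT => <- //.
by apply: eq_measure_integral => /= B mB _; rewrite lebesgue_measure_translate.
Qed.

Lemma ge0_integral_translate d (z : 'rV[R]_d) (f : 'rV[R]_d -> \bar R) :
  measurable_fun setT f -> (forall x, 0 <= f x)%E ->
  (\int[@lebesgue_Rd R d]_x f (x + z)%R = \int[@lebesgue_Rd R d]_x f x)%E.
Proof.
move=> mf f0.
have := ge0_integral_pushforward (measurable_addr_rV z) (@lebesgue_Rd R d) measurableT mf.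
rewrite preimage_setT => <- //.
apply: eq_measure_integral => /= [|mz B mB _]; first exact: measurable_addr_rV.
exact: lebesgue_Rd_translate.
Qed.

Lemma integral_translate d (z : 'rV[R]_d) (f : 'rV[R]_d -> \bar R) :
  measurable_fun setT f ->
  (\int[@lebesgue_Rd R d]_x f (x + z)%R = \int[@lebesgue_Rd R d]_x f x)%E.
Proof.
move=> mf; rewrite integralE [RHS]integralE; congr (_ - _)%E.
- rewrite -[RHS](ge0_integral_translate z (measurable_funepos mf))//.
  by apply: eq_integral => x _; rewrite !funeposE.
- rewrite -[RHS](ge0_integral_translate z (measurable_funeneg mf))//.
  by apply: eq_integral => x _; rewrite !funenegE.
Qed.

End translation.

(** * C^1 functions of compact support *)

Section rV_topology.
Context {R : realType}.

(** The sigma-algebra is generated by coordinates, not by open sets, so second countability enters: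
    an open set is the union of the cubes with rational centre and radius [1/(n+1)] that it
    contains. *)
Lemma open_measurable_rV d (U : set 'rV[R]_d) : open U -> measurable U.
Proof.
move=> oU.
pose c (q : 'rV[rat]_d) : 'rV[R]_d := \row_i ratr (q ord0 i).
pose F (p : 'rV[rat]_d * nat) : set 'rV[R]_d :=
  [set y | cube (c p.1) p.2.+1%:R^-1 `<=` U /\ cube (c p.1) p.2.+1%:R^-1 y].
rewrite (_ : U = \bigcup_p F p).
  apply: countable_bigcupT_measurable; first exact: countableP.
  move=> p; have [h|h] := pselect (cube (c p.1) p.2.+1%:R^-1 `<=` U).
    rewrite (_ : F p = cube (c p.1) p.2.+1%:R^-1); first exact: measurable_cube.
    by apply/seteqP; split => y; rewrite /F /=; tauto.
  rewrite (_ : F p = set0); first exact: measurable0.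
  by apply/seteqP; split => y; rewrite /F /=; tauto.
apply/seteqP; split => y; last by move=> [p _ [h]]; exact: h.
move=> Uy; have /nbhs_ballP[e /= e0 eU] := open_nbhs_nbhs (conj oU Uy).
(* This gives [2/(n+1) < e]: a cube of radius [1/(n+1)] whose centre is within [1/(n+1)] of [y]
   stays in the ball of radius [e] about [y]. *)
pose n := Num.truncn (2 / e).
have n0 : 0 < n.+1%:R^-1 :> R by rewrite invr_gt0.
have ne : n.+1%:R^-1 + n.+1%:R^-1 < e.
  have : 2 / e < n.+1%:R by exact: truncnS_gt.
  rewrite ltr_pdivrMr// => h.
  by rewrite -mulr2n -[_ *+ 2]mulr_natl ltr_pdivrMr// mulrC.
have /choice[q qP] (i : 'I_d) : exists q : rat, `|ratr q - y ord0 i| < n.+1%:R^-1.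
  have /rat_in_itvoo[q] : y ord0 i - n.+1%:R^-1 < y ord0 i + n.+1%:R^-1.
    by rewrite ltrBlDr -addrA ltrDl addr_gt0.
  by rewrite in_itv/= => /andP[h1 h2]; exists q; rewrite ltr_distl h1 h2.
exists (\row_i q i, n) => //; split => /=; last first.
  by move=> i; rewrite !mxE distrC.
move=> x hx; apply: eU; rewrite ball_cube// => i.
have := hx i; rewrite !mxE => h; have := qP i.
move: ne h; set a := (_^-1) => ne h1 h2.
apply: le_lt_trans ne; rewrite (le_trans (ler_distD (ratr (q i)) _ _))//.
by rewrite lerD// ltW.
Qed.

Lemma continuous_measurable_rV d (f : 'rV[R]_d -> R) :
  continuous f -> measurable_fun setT f.
Proof.
move=> /continuousP cf; apply: (measurability _ (RGenOpens.measurableE R)).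
move=> _ [_ [a [b ->] <-]]; rewrite setTI; apply: open_measurable_rV.
exact/cf/interval_open.
Qed.

(** Induction over displacements: [P z a] reads as a move by [z] at cost [a]. A subadditive cost
    known along the axes is summed over the coordinates of [z]. *)
Lemma rV_coord_ind d (P : 'rV[R]_d -> R -> Prop) (C : R) : P 0 0 ->
  (forall z w a b, P z a -> P w b -> P (z + w) (a + b)) ->
  (forall i t, P (t *: basis_vec i) (C * `|t|)) ->
  forall z, P z (C * \sum_i `|z ord0 i|).
Proof.
move=> P0 PD Pe z; rewrite {1}(row_sum_delta z) mulr_sumr.
elim/big_ind2 : _ => // [w b w' b' h h'|i _]; first exact: PD.
exact: Pe.
Qed.

Lemma sum_coord_le d (z : 'rV[R]_d) : \sum_i `|z ord0 i| <= d%:R * `|z|.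
Proof.
apply: (le_trans (ler_sum _ (fun i _ => ler_coord_norm z i))).
by rewrite sumr_const card_ord mulr_natl.
Qed.

Lemma lipschitz_of_is_derive (f df : R -> R) (K : R) :
  (forall x : R, is_derive x (1 : R) f (df x)) -> (forall x, `|df x| <= K) ->
  forall a b, `|f b - f a| <= K * `|b - a|.
Proof.
move=> fd fK a b; wlog ab : a b / a <= b.
  by move=> h; have [/h//|/ltW/h] := leP a b; rewrite distrC (distrC a).
have [|c _ ->] := @MVT_segment _ f df a b ab (fun x _ => fd x).
  apply: continuous_subspaceT => x.
  by apply/differentiable_continuous/derivable1_diffP; exact: ex_derive.
by rewrite normrM ler_wpM2r.
Qed.

Lemma is_derive_line d (f : 'rV[R]_d -> R) (x v : 'rV[R]_d) (t : R) :
  derivable f (x + t *: v) v ->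
  is_derive t (1 : R) (fun s : R => f (x + s *: v)) ('D_v f (x + t *: v)).
Proof.
move=> df.
suff E : (fun h : R => h^-1 *: (((fun s : R => f (x + s *: v)) \o shift t) (h *: 1) -
    f (x + t *: v))) =
  (fun h : R => h^-1 *: ((f \o shift (x + t *: v)) (h *: v) - f (x + t *: v))).
  by split; rewrite /derivable /derive E.
apply/funext => h /=; congr (_ *: (f _ - _)).
by rewrite scalerDl [h *: 1]mulr1 addrCA.
Qed.

Lemma line_lipschitz d (f : 'rV[R]_d -> R) (v : 'rV[R]_d) (K : R) :
  (forall x, derivable f x v) -> (forall x, `|'D_v f x| <= K) ->
  forall x t, `|f (x + t *: v) - f x| <= K * `|t|.
Proof.
move=> df fK x t.
have := @lipschitz_of_is_derive (fun s => f (x + s *: v)) _ K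
  (fun s => is_derive_line (df _)) (fun s => fK _) 0 t.
by rewrite scale0r addr0 subr0.
Qed.

End rV_topology.

Section compact_support.
Context {R : realType} (d : nat).
Local Notation Rd := 'rV[R]_d.

(** A form of compact support that passes at once to derivatives, translates and components. *)
Definition bounded_support (V : lmodType R) (f : Rd -> V) : Prop :=
  exists M : R, forall x, M < `|x| -> f x = 0.

Lemma bounded_supportP (V : lmodType R) (f : Rd -> V) :
  bounded_support f <-> compact (closure [set x | f x != 0]).
Proof.
split => [[M fM]|/compact_bounded].
  apply: bounded_closed_compact; last exact: closed_closure.
  have cM : closed (fun x : Rd => `|x| <= M).
    apply: (closed_comp _ (@closed_le _ M)) => x _.
    exact: norm_continuous.
  exists M; split; first exact: num_real.
  have sub : [set x | f x != 0] `<=` [set x | `|x| <= M].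
    by move=> x /= fx; rewrite leNgt; apply: contra_neqN fx => /fM.
  move=> r Mr x clx; apply: le_trans (ltW Mr).
  by have := closure_subset sub clx; rewrite -((closure_id _).1 cM).
move=> [M [Mr hM]]; exists (M + 1) => x hx.
apply/eqP/negP => /negP fx.
have : `|x| <= M + 1 by apply: (hM (M + 1)); [rewrite ltrDl|exact: subset_closure].
by rewrite leNgt hx.
Qed.

End compact_support.

Section C1_functions.
Context {R : realType} (d : nat).
Local Notation Rd := 'rV[R]_d.

(** Differentiability is along the axes, as in [test_field]; continuity is listed separately because
    partial derivatives alone do not give it. *)
Definition C1fun (f : Rd -> R) : Prop :=
  [/\ continuous f, forall i x, derivable f x (basis_vec i) &
      forall i, continuous (fun x => 'D_(basis_vec i) f x)].

Lemma derive_eq0_outside (f : Rd -> R) (M : R) v :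
  (forall x, M < `|x| -> f x = 0) -> forall x, M < `|x| -> 'D_v f x = 0.
Proof.
move=> fM x Mx; rewrite -(derive_cst (0 : R) x v).
apply: near_eq_derive.
have oM : open [set y : Rd | M < `|y|].
  apply: (open_comp _ (@open_gt _ M)) => y _.
  exact: norm_continuous.
by have := open_nbhs_nbhs (conj oM Mx); apply: filterS => y /fM.
Qed.

Lemma bounded_support_derive (f : Rd -> R) v :
  bounded_support f -> bounded_support (fun x => 'D_v f x).
Proof. by move=> [M fM]; exists M; exact: derive_eq0_outside. Qed.

Lemma bounded_of_bounded_support (f : Rd -> R) : continuous f ->
  bounded_support f -> exists2 K, 0 <= K & forall x, `|f x| <= K.
Proof.
move=> cf [M fM].
have cM : compact [set x : Rd | `|x| <= M].
  apply: bounded_closed_compact.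
    exists M; split; first exact: num_real.
    by move=> r Mr x /= xM; rewrite (le_trans xM)// ltW.
  apply: (closed_comp _ (@closed_le _ M)) => x _.
  exact: norm_continuous.
have /compact_bounded[K [_ fK]] : compact (f @` [set x : Rd | `|x| <= M]).
  by apply: continuous_compact => //; exact: continuous_subspaceT.
have K1 : K < `|K| + 1 by rewrite (le_lt_trans (ler_norm _))// ltrDl.
exists (`|K| + 1) => // x; have [xM|/fM ->] := leP `|x| M.
  by apply: (fK _ K1); exists x.
by rewrite normr0.
Qed.

(** [test_field] does not mention continuity of the components. Bounded support makes the continuous
    partial derivatives bounded, and moving along one axis at a time gives a Lipschitz bound, hence
    continuity. *)
Lemma C1fun_of_partials (f : Rd -> R) :
  (forall i x, derivable f x (basis_vec i)) ->
  (forall i, continuous (fun x => 'D_(basis_vec i) f x)) ->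
  bounded_support f -> C1fun f.
Proof.
move=> df cdf bf; split => //.
have /choice[K /all_and2[K0 fK]] i : exists K, 0 <= K /\
    forall x, `|'D_(basis_vec i) f x| <= K.
  have [K K0 h] := bounded_of_bounded_support (cdf i) (bounded_support_derive (basis_vec i) bf).
  by exists K.
pose C := \sum_i K i.
have fC i x : `|'D_(basis_vec i) f x| <= C.
  by rewrite (le_trans (fK i x))// /C (bigD1 i)//= lerDl sumr_ge0.
have lf z : forall x, `|f (x + z) - f x| <= C * \sum_i `|z ord0 i|.
  apply: (@rV_coord_ind _ _ (fun z a => forall x, `|f (x + z) - f x| <= a)) => //.
  - by move=> x; rewrite addr0 subrr normr0.
  - move=> z1 z2 a b h1 h2 x; rewrite addrA [a + b]addrC.
    by rewrite (le_trans (ler_distD (f (x + z1)) _ _))// lerD.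
  - by move=> i t x; exact: (line_lipschitz (df i) (fC i)).
have C0 : 0 <= C by exact: sumr_ge0.
move=> x; apply/(@cvgrPdist_le _ _ _ (nbhs x)) => e e0.
(* The added [1] keeps [D] positive, so that [e / D] is a valid radius. *)
pose D := C * d%:R + 1.
have D0 : 0 < D by rewrite ltr_wpDl// mulr_ge0.
near=> y.
have := lf (y - x) x; rewrite [x + _]addrC subrK distrC => /le_trans; apply.
rewrite (@le_trans _ _ (D * `|y - x|))//.
  rewrite (le_trans (ler_wpM2l C0 (sum_coord_le _)))// mulrA ler_wpM2r//.
  by rewrite lerDl.
rewrite mulrC -ler_pdivlMr// distrC.
near: y.
apply: filterS (nbhsx_ballx x (e / D) _); last exact: divr_gt0.
by move=> y; rewrite -ball_normE/= => /ltW.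
Unshelve. all: by end_near. Qed.

Lemma C1fun_cst (a : R) : C1fun (cst a).
Proof.
split; first exact: cst_continuous.
  by move=> i x; exact: derivable_cst.
move=> i; rewrite (_ : (fun _ => _) = cst 0); first exact: cst_continuous.
by apply/funext => x; rewrite derive_cst.
Qed.

Lemma C1funB (f g : Rd -> R) : C1fun f -> C1fun g -> C1fun (f - g).
Proof.
move=> [cf df Df] [cg dg Dg]; split.
- by move=> x; apply: continuousB; [exact: cf|exact: cg].
- by move=> i x; apply: derivableB; [exact: df|exact: dg].
- move=> i; rewrite (_ : (fun _ => _) =
    (fun x => 'D_(basis_vec i) f x) - (fun x => 'D_(basis_vec i) g x)).
    by move=> x; apply: continuousB; [exact: Df|exact: Dg].
  by apply/funext => x; rewrite deriveB.
Qed.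

Lemma C1funM (f g : Rd -> R) : C1fun f -> C1fun g -> C1fun (f * g).
Proof.
move=> [cf df Df] [cg dg Dg]; split.
- by move=> x; apply: continuousM; [exact: cf|exact: cg].
- by move=> i x; apply: derivableM; [exact: df|exact: dg].
- move=> i; rewrite (_ : (fun _ => _) =
    f * (fun x => 'D_(basis_vec i) g x) + g * (fun x => 'D_(basis_vec i) f x)).
    move=> x; apply: continuousD; apply: continuousM.
    + exact: cf.
    + exact: Dg.
    + exact: cg.
    + exact: Df.
  by apply/funext => x; rewrite deriveM.
Qed.

Lemma C1fun_coord (s ds : R -> R) (i : 'I_d) :
  (forall t : R, is_derive t (1 : R) s (ds t)) -> continuous ds ->
  C1fun (fun x : Rd => s (x ord0 i)).
Proof.
move=> dsE cds.
have cs : continuous s.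
  move=> t; apply/differentiable_continuous/derivable1_diffP.
  exact: ex_derive.
have H j x : is_derive x (basis_vec j) (fun x : Rd => s (x ord0 i))
    (ds (x ord0 i) * (j == i)%:R).
  have E h : s ((h *: basis_vec j + x) ord0 i) = s (h * (j == i)%:R + x ord0 i).
    by rewrite !mxE eqxx/= eq_sym.
  have [->|ji] := eqVneq j i.
    rewrite mulr1; have [d1 d2] := dsE (x ord0 i).
    suff E' : (fun h : R => h^-1 *: ((((fun x : Rd => s (x ord0 i)) \o shift x)
       (h *: basis_vec i)) - s (x ord0 i))) =
      (fun h : R => h^-1 *: ((s \o shift (x ord0 i)) (h *: (1 : R)) - s (x ord0 i))).
      by split; rewrite /derivable /derive E'.
    by apply/funext => h; rewrite /= !mxE !eqxx/=.
  rewrite mulr0.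
  suff E' : (fun h : R => h^-1 *: ((((fun x : Rd => s (x ord0 i)) \o shift x)
       (h *: basis_vec j)) - s (x ord0 i))) = cst 0.
    split; rewrite /derivable /derive E'; first exact: is_cvg_cst.
    by apply/cvg_lim => //; exact: cvg_cst.
  apply/funext => h; rewrite /= !mxE eqxx/= eq_sym (negbTE ji) mulr0 add0r subrr.
  by rewrite scaler0.
split.
- by move=> x; apply: continuous_comp; [exact: coord_continuous|exact: cs].
- by move=> j x; exact: ex_derive.
- move=> j; rewrite (_ : (fun x => 'D_(basis_vec j) _ x) = (fun x : Rd => ds (x ord0 i) * (j == i)%:R)).
    move=> x; apply: (@continuousM _ _ (fun x : Rd => ds (x ord0 i)) (cst (j == i)%:R) x).
      by apply: continuous_comp; [exact: coord_continuous|exact: cds].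
    exact: cst_continuous.
  by apply/funext => x; rewrite derive_val.
Qed.

Lemma derive_translate (f : Rd -> R) z v x :
  'D_v (fun y => f (y + z)) x = 'D_v f (x + z).
Proof.
have E : (fun h : R => h^-1 *: (((fun x => f (x + z)) \o shift x) (h *: v) - f (x + z))) =
   (fun h : R => h^-1 *: ((f \o shift (x + z)) (h *: v) - f (x + z))).
  by apply/funext => h /=; rewrite addrA.
by rewrite /derive E.
Qed.

Lemma C1fun_translate (f : Rd -> R) z : C1fun f -> C1fun (fun x => f (x + z)).
Proof.
move=> [cf df Df].
have E x v : (fun h : R => h^-1 *: (((fun x => f (x + z)) \o shift x) (h *: v) - f (x + z))) =
   (fun h : R => h^-1 *: ((f \o shift (x + z)) (h *: v) - f (x + z))).
  by apply/funext => h /=; rewrite addrA.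
have caddz : continuous (fun x : Rd => x + z).
  by move=> x; apply: (@cvgD _ _ _ (nbhs x) _ id (cst z)); [exact: cvg_id|exact: cvg_cst].
split.
- by move=> x; apply: continuous_comp; [exact: caddz|exact: cf].
- by move=> i x; rewrite /derivable E; exact: df.
- move=> i; rewrite (_ : (fun x => 'D_(basis_vec i) _ x) = (fun x => 'D_(basis_vec i) f x) \o (fun x : Rd => x + z)).
    by move=> x; apply: continuous_comp; [exact: caddz|exact: Df].
  by apply/funext => x /=; rewrite /derive E.
Qed.

Lemma bounded_support_translate (f : Rd -> R) z :
  bounded_support f -> bounded_support (fun x => f (x + z)).
Proof.
move=> [M fM]; exists (M + `|z|) => x hx; apply: fM.
have := ler_normB (x + z) z; rewrite addrK => h.
by move: hx => /lt_le_trans/(_ h); rewrite ltrD2r.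
Qed.

Lemma C1fun_scale (f : Rd -> R) (a : R) : C1fun f -> C1fun (fun x => f (a *: x)).
Proof.
move=> [cf df Df].
have H i x : is_derive x (basis_vec i) (fun x => f (a *: x))
    (a * 'D_(basis_vec i) f (a *: x)).
  have h : derivable f (a *: x + 0 *: basis_vec i) (basis_vec i) by exact: df.
  have d1 := is_derive_line h.
  have dl : is_derive (0 : R) (1 : R) (fun s : R => a * s) a.
    have := is_deriveZ a (is_derive_id (0 : R) (1 : R)).
    by move=> h'; apply: (is_derive_eq h'); rewrite [_ *: _]mulr1.
  have d1' : is_derive (a * 0) (1 : R) (fun s : R => f (a *: x + s *: basis_vec i))
      ('D_(basis_vec i) f (a *: x)).
    by rewrite mulr0; move: d1; rewrite scale0r addr0.
  have [d2 d2E] := is_derive1_comp d1' dl.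
  (* The difference quotient along [basis_vec i] is that of a one-variable composite with
     [s |-> a * s] at 0, to which the chain rule applies. *)
  have E : (fun h : R => h^-1 *: (((fun x => f (a *: x)) \o shift x) (h *: basis_vec i) - f (a *: x))) =
    (fun h : R => h^-1 *: ((((fun s : R => f (a *: x + s *: basis_vec i)) \o (fun s : R => a * s)) \o shift 0)
       (h *: (1 : R)) - ((fun s : R => f (a *: x + s *: basis_vec i)) \o (fun s : R => a * s)) 0)).
    apply/funext => h' /=; rewrite mulr0 scale0r !addr0 [h' *: 1]mulr1.
    by congr (_ *: (f _ - _)); rewrite scalerDr scalerA addrC.
  split; first by rewrite /derivable E.
  by rewrite /derive E mulrC -d2E.
have cs : continuous (fun x : Rd => a *: x) by exact: scaler_continuous.
split.
- by move=> x; apply: continuous_comp; [exact: cs|exact: cf].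
- by move=> i x; have [] := H i x.
- move=> i; rewrite (_ : (fun x => 'D_(basis_vec i) _ x) =
    (fun x : Rd => cst a x * ((fun x => 'D_(basis_vec i) f x) \o (fun x => a *: x)) x)).
    move=> x; apply: continuousM; first exact: cst_continuous.
    by apply: continuous_comp; [exact: cs|exact: Df].
  by apply/funext => x; rewrite derive_val.
Qed.

Lemma C1fun_measurable (f : Rd -> R) : C1fun f -> measurable_fun setT f.
Proof. by case=> cf _ _; exact: continuous_measurable_rV. Qed.

End C1_functions.

(** * Explicit C^1 steps and cutoffs *)

Section step_and_cutoff.
Context {R : realType}.

(** Squaring the positive part removes its kink: the result is C^1, which is all that the test
    functions need. Both the step and the cutoff are built on it. *)
Definition sqpos (t : R) : R := Num.max 0 t ^+ 2.

Lemma sqpos_ge0 t : 0 <= sqpos t.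
Proof. exact: sqr_ge0. Qed.

Lemma continuous_max0 : continuous (fun t : R => Num.max 0 t).
Proof.
move=> t; apply: (@continuous_max _ _ (cst 0) id); first exact: cst_continuous.
exact: cvg_id.
Qed.

Lemma is_derive_sqr (t : R) : is_derive t (1 : R) (fun y : R => y ^+ 2) (2 * t).
Proof.
split; first exact: exprn_derivable.
by rewrite exp_derive /= expr1 [_ *: 1]mulr1 -[_ *: t]/(_ * t).
Qed.

Lemma is_derive_sqpos (t : R) : is_derive t (1 : R) sqpos (2 * Num.max 0 t).
Proof.
have [t0|t0|->] := ltgtP t 0.
- have nt : \forall y \near t, cst 0 y = sqpos y.
    near=> y; rewrite /sqpos max_l ?expr0n//=.
    near: y; apply: filterS (open_nbhs_nbhs (conj (@open_lt R 0) t0)) => y.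
    exact: ltW.
  rewrite mulr0.
  exact: (near_eq_is_derive nt (is_derive_cst _ _ _)).
- have nt : \forall y \near t, y ^+ 2 = sqpos y.
    near=> y; rewrite /sqpos max_r//.
    near: y; apply: filterS (open_nbhs_nbhs (conj (@open_gt R 0) t0)) => y.
    exact: ltW.
  apply: (near_eq_is_derive nt).
  exact: is_derive_sqr.
- rewrite mulr0.
  (* At the kink the difference quotient is at most [|h|] in absolute value. *)
  have H : (fun h : R => h^-1 *: ((sqpos \o shift 0) (h *: (1 : R)) - sqpos 0)) @ 0^' --> (0 : R).
    apply/cvgrPdist_le => e e0; near=> h.
    have h0 : h != 0 by near: h; exact: nbhs_dnbhs_neq.
    rewrite sub0r normrN /= addr0 [h *: 1]mulr1 {2}/sqpos maxxx expr0n/= subr0.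
    rewrite [_ *: _]mulrC normrM normfV ler_pdivrMr ?normr_gt0//.
    rewrite /sqpos normrX expr2 (@le_trans _ _ (`|h| * `|h|))//.
      rewrite ler_pM//; case: (leP 0 h) => hh; rewrite ?normr0//.
    rewrite ler_wpM2r//; near: h; apply: dnbhs0_le => //.
  by split; [apply/cvg_ex; exists 0|apply/cvg_lim].
Unshelve. all: by end_near. Qed.

(** Rational C^1 step with values in [0, 1[, zero on the negative axis; [step (n t)] tends to the
    indicator of [t > 0]. *)
Definition step (t : R) : R := 1 - (1 + sqpos t)^-1.

Lemma step_den_gt0 t : 0 < 1 + sqpos t.
Proof. by rewrite ltr_pwDl// sqpos_ge0. Qed.

Lemma is_derive_step (t : R) :
  is_derive t (1 : R) step ((1 + sqpos t) ^- 2 * (2 * Num.max 0 t)).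
Proof.
have := is_derive_sqpos t; move=> dp.
have t0 : (1 + sqpos t) != 0 by rewrite gt_eqF// step_den_gt0.
have d1 : is_derive t (1 : R) (cst 1 + sqpos) (0 + 2 * Num.max 0 t).
  exact: is_deriveD.
have d2 := @is_deriveV _ (cst 1 + sqpos) t _ 1 t0 d1.
have d3 := is_deriveB (is_derive_cst (1 : R) t (1 : R)) d2.
apply: (@is_derive_eq _ _ _ _ _ _ _ _ d3).
by rewrite !add0r scaleNr opprK.
Qed.

Lemma continuous_sqpos : continuous sqpos.
Proof.
move=> t; apply/differentiable_continuous/derivable1_diffP.
by have [] := is_derive_sqpos t.
Qed.

Lemma continuous_dstep :
  continuous (fun t : R => (1 + sqpos t) ^- 2 * (2 * Num.max 0 t)).
Proof.
move=> t; apply: cvgM; last first.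
  by apply: cvgM; [exact: cvg_cst|exact: continuous_max0].
apply: cvgV; first by rewrite sqrf_eq0 gt_eqF// step_den_gt0.
apply: cvgM; apply: cvgD; try exact: cvg_cst; exact: continuous_sqpos.
Qed.

Lemma step_itv t : 0 <= step t <= 1.
Proof.
have h := step_den_gt0 t.
rewrite /step subr_ge0 invf_le1// lerDl sqpos_ge0/=.
by rewrite gerBl invr_ge0 ltW.
Qed.

Lemma cvg_step (t : R) : step (n%:R * t) @[n --> \oo] --> ((0 < t)%R%:R : R).
Proof.
have [t0|t0] := ltP 0 t; last first.
  rewrite (_ : (fun _ => _) = cst 0); first exact: cvg_cst.
  apply/funext => n; rewrite /step /sqpos max_l ?expr0n/= ?addr0 ?invr1 ?subrr//.
  by rewrite mulr_ge0_le0.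
rewrite -[X in _ --> X]subr0; apply: cvgB; first exact: cvg_cst.
apply/gtr0_cvgV0; first by apply: nearW => n; exact: step_den_gt0.
apply/cvgryPge => A; near=> n.
have n1 : 1 <= n%:R * t.
  by rewrite -ler_pdivrMr//; near: n; exact: nbhs_infty_ger.
rewrite /sqpos max_r ?(le_trans ler01 n1)//.
rewrite (@le_trans _ _ (n%:R * t))//.
  by rewrite -ler_pdivrMr//; near: n; exact: nbhs_infty_ger.
by rewrite (@le_trans _ _ ((n%:R * t) ^+ 2)) ?lerDr// ler_eXnr.
Unshelve. all: by end_near. Qed.

(** A C^1 bump [((1 - t^2)^+)^2], equal to 1 at 0 and to 0 outside [-1, 1]. *)
Definition cut (t : R) : R := sqpos (1 - t ^+ 2).

Lemma is_derive_cut (t : R) :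
  is_derive t (1 : R) cut (2 * Num.max 0 (1 - t ^+ 2) * (- (2 * t))).
Proof.
have d1 : is_derive t (1 : R) (fun t : R => 1 - t ^+ 2) (- (2 * t)).
  apply: (@is_derive_eq _ _ _ _ _ _ _ _
    (is_deriveB (is_derive_cst (1 : R) t (1 : R)) (is_derive_sqr t))).
  by rewrite sub0r.
exact: (@is_derive1_comp _ sqpos _ t _ _ (is_derive_sqpos _) d1).
Qed.

Lemma continuous_dcut :
  continuous (fun t : R => 2 * Num.max 0 (1 - t ^+ 2) * (- (2 * t))).
Proof.
have c2 : continuous (fun t : R => 1 - t ^+ 2).
  by move=> t; apply: cvgB; [exact: cvg_cst|exact: exprn_continuous].
move=> t; apply: cvgM; last by apply: cvgN; apply: cvgM; [exact: cvg_cst|exact: cvg_id].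
apply: cvgM; first exact: cvg_cst.
apply: (@continuous_max _ _ (cst 0) (fun t : R => 1 - t ^+ 2)).
  exact: cst_continuous.
exact: c2.
Qed.

Lemma cut_itv t : 0 <= cut t <= 1.
Proof.
rewrite /cut sqpos_ge0/= /sqpos.
have h : 0 <= Num.max 0 (1 - t ^+ 2) <= 1.
  by rewrite le_max lexx/= ge_max ler01 gerBl sqr_ge0.
by case/andP: h => h1 h2; rewrite exprn_ile1.
Qed.

Lemma cut0 : cut 0 = 1.
Proof. by rewrite /cut expr0n subr0 /sqpos max_r ?expr1n. Qed.

Lemma cut_eq0 t : 1 < `|t| -> cut t = 0.
Proof.
move=> t1; rewrite /cut /sqpos max_l ?expr0n//.
by rewrite subr_le0 -real_normK ?num_real// expr_ge1// ltW.
Qed.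

(** Not constant near the origin: the value 1 at 0 and continuity suffice, since only the pointwise
    limit of its dilations is used. *)
Definition cutoff d (x : 'rV[R]_d) : R := \prod_i cut (x ord0 i).

Lemma C1fun_cutoff d : C1fun (@cutoff d).
Proof.
rewrite (_ : @cutoff d = \prod_i (fun x : 'rV[R]_d => cut (x ord0 i))); last first.
  by apply/funext => x; rewrite /cutoff fct_prodE.
elim/big_ind : _ => [|f g|i _]; first exact: C1fun_cst.
- exact: C1funM.
- exact: (C1fun_coord _ is_derive_cut continuous_dcut).
Qed.

Lemma cutoff_itv d (x : 'rV[R]_d) : 0 <= cutoff x <= 1.
Proof.
rewrite /cutoff; elim/big_ind : _ => [|a b /andP[a0 a1] /andP[b0 b1]|i _].
- by rewrite ler01 lexx.
- by rewrite mulr_ge0//= mulr_ile1.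
- exact: cut_itv.
Qed.

Lemma cutoff0 d : cutoff (0 : 'rV[R]_d) = 1.
Proof. by rewrite /cutoff big1// => i _; rewrite mxE cut0. Qed.

Lemma bounded_support_cutoff d : bounded_support (@cutoff d).
Proof.
exists 1 => x x1.
suff [i xi] : exists i, 1 < `|x ord0 i|.
  by rewrite /cutoff (bigD1 i)//= cut_eq0// mul0r.
apply: contrapT => /forallNP h.
suff : `|x| <= 1 by rewrite leNgt x1.
rewrite [leLHS]/Num.Def.normr/= mx_normrE.
apply/bigmax_leP; split => // -[k i] _ /=; rewrite ord1 leNgt.
exact/negP.
Qed.

End step_and_cutoff.

(** * Duality for the L^1 norm *)

Section weighted_distance.
Context d (T : measurableType d) (R : realType) (mu : {measure set T -> \bar R}).
Variable w : T -> R.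
Hypothesis wi : mu.-integrable setT (EFin \o w).

Let mw : measurable_fun setT w.
Proof. by apply/measurable_EFinP; case/integrableP: wi. Qed.

Lemma integrable_mulr_bounded (h : T -> R) (K : R) : measurable_fun setT h ->
  (forall x, `|h x| <= K) -> mu.-integrable setT (fun x => (w x * h x)%:E).
Proof.
move=> mh hK.
have -> : (fun x => (w x * h x)%:E) = ((EFin \o w) \* (EFin \o h))%E.
  by apply/funext => x /=; rewrite EFinM.
apply: integrableMl => //.
exists K; split; first exact: num_real.
by move=> r Kr x _ /=; rewrite (le_trans (hK x))// ltW.
Qed.

(** The norm of [f] in L^1 of the measure [|w| mu]. *)
Definition wnorm (f : T -> R) : \bar R := (\int[mu]_x (`|w x * f x|)%:E)%E.

Arguments wnorm f%_ring_scope.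

Lemma wnorm_le (f g h : T -> R) : measurable_fun setT f ->
  measurable_fun setT g -> measurable_fun setT h ->
  (forall x, `|f x| <= `|g x| + `|h x|) ->
  (wnorm f <= wnorm g + wnorm h)%E.
Proof.
move=> mf mg mh fgh; rewrite /wnorm -ge0_integralD//; last 2 first.
- by apply/measurable_EFinP; apply: measurableT_comp => //; exact: measurable_funM.
- by apply/measurable_EFinP; apply: measurableT_comp => //; exact: measurable_funM.
apply: ge0_le_integral => //.
- by apply/measurable_EFinP; apply: measurableT_comp => //; exact: measurable_funM.
- apply/measurable_EFinP; apply: measurable_funD;
  by apply: measurableT_comp => //; exact: measurable_funM.
- by move=> x _; rewrite -EFinD lee_fin !normrM -mulrDr ler_wpM2l.
Qed.

Lemma eq_wnorm (f g : T -> R) : (forall x, `|f x| = `|g x|) -> wnorm f = wnorm g.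
Proof. by move=> fg; apply: eq_integral => x _; rewrite !normrM fg. Qed.

Lemma wnorm_cvg0 (f_ : nat -> T -> R) (f : T -> R) (K : R) :
  (forall n, measurable_fun setT (f_ n)) -> (forall n x, `|f_ n x| <= K) ->
  (forall x, f_ n x @[n --> \oo] --> f x) ->
  forall e, 0 < e -> exists n, (wnorm (f - f_ n) <= e%:E)%E.
Proof.
move=> mf_ f_K f_f e e0.
have mf : measurable_fun setT f.
  apply/measurable_EFinP; apply: (emeasurable_fun_cvg (fun n x => (f_ n x)%:E)).
    by move=> n; exact/measurable_EFinP.
  by move=> x _; apply/cvg_EFin; [exact: nearW|exact: f_f].
have Ki : mu.-integrable setT (fun x => (w x * K)%:E).
  exact: (@integrable_mulr_bounded (cst K) `|K|).
have [|||||_ h _] := @dominated_convergence _ _ _ mu _ measurableT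
   (fun n x => (w x * f_ n x)%:E) (fun x => (w x * f x)%:E)
   (fun x => `|(w x * K)%:E|)%E.
- by move=> n; apply/measurable_EFinP/measurable_funM.
- by apply/measurable_EFinP/measurable_funM.
- apply/aeW => x _; apply/cvg_EFin; first exact: nearW.
  by apply: cvgM; [exact: cvg_cst|exact: f_f].
- exact: integrable_abse.
- apply/aeW => x n _; rewrite /= lee_fin !normrM ler_wpM2l//.
  by rewrite (le_trans (f_K n x))// ler_norm.
have /fine_cvgP[h1 /cvgrPdist_le h2] := h.
near \oo => n; exists n.
have -> : wnorm (f - f_ n) = (\int[mu]_x `|(w x * f_ n x)%:E - (w x * f x)%:E|)%E.
  apply: eq_integral => x _; rewrite -EFinB -mulrBr abse_EFin !normrM.
  by rewrite -[(f - f_ n) x]/(f x - f_ n x) (distrC (f x)).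
have : (\int[mu]_x `|(w x * f_ n x)%:E - (w x * f x)%:E|)%E \is a fin_num by near: n.
move/fineK => <-; rewrite lee_fin.
have : `|0 - fine (\int[mu]_x `|(w x * f_ n x)%:E - (w x * f x)%:E|)%E| <= e.
  by near: n; exact: h2.
by rewrite sub0r normrN; exact: le_trans (ler_norm _).
Unshelve. all: by end_near. Qed.

Lemma integral_le_wnorm (f g : T -> R) (K : R) : measurable_fun setT f ->
  measurable_fun setT g -> (forall x, `|f x| <= K) -> (forall x, `|g x| <= K) ->
  (\int[mu]_x (w x * f x)%:E <= \int[mu]_x (w x * g x)%:E + wnorm (f - g))%E.
Proof.
move=> mf mg fK gK.
have fi := integrable_mulr_bounded mf fK.
have gi := integrable_mulr_bounded mg gK.
have fgi : mu.-integrable setT (fun x => (`|w x * (f - g) x|)%:E).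
  rewrite (_ : (fun _ => _) = abse \o (fun x => (w x * (f - g) x)%:E))//.
  apply: integrable_abse; apply: (@integrable_mulr_bounded _ (K + K)).
    exact: measurable_funB.
  by move=> x; rewrite (le_trans (ler_normB _ _))// lerD.
rewrite /wnorm -integralD//; apply: le_integral => //.
  exact: integrableD.
move=> x _; rewrite -EFinD lee_fin -lerBlDl -mulrBr.
exact: ler_norm.
Qed.

End weighted_distance.
Arguments wnorm {d T R} mu w%_ring_scope f%_ring_scope.

Section norming.
Context {R : realType} (d : nat).
Local Notation Rd := 'rV[R]_d.
Local Notation leb := (@lebesgue_Rd R d).
Variable w : Rd -> R.
Hypothesis wi : leb.-integrable setT (EFin \o w).

(* These sets form a sigma-algebra containing the half-spaces, so the sign of [w]
   can be approximated by C^1 functions in L^1(|w|). *)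
Definition C1_approximable (E : set Rd) : Prop := measurable E /\
  forall e, 0 < e -> exists g, [/\ C1fun g, forall x, 0 <= g x <= 1 &
    (wnorm leb w (\1_E - g) <= e%:E)%E].

Lemma indic_itv (E : set Rd) x : 0 <= (\1_E x : R) <= 1.
Proof. by rewrite indicE; case: (_ \in _); rewrite ?lexx ?ler01. Qed.

Lemma C1_approximable_lim (E : set Rd) (g_ : nat -> Rd -> R) : measurable E ->
  (forall n, C1fun (g_ n)) -> (forall n x, 0 <= g_ n x <= 1) ->
  (forall x, g_ n x @[n --> \oo] --> (\1_E x : R)) -> C1_approximable E.
Proof.
move=> mE Cg g01 gE; split=> // e e0.
have [||n hn] := @wnorm_cvg0 _ _ _ leb w wi g_ (\1_E) 1 _ _ gE _ e0.
- by move=> n; exact: C1fun_measurable.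
- by move=> n x; have /andP[h1 h2] := g01 n x; rewrite ger0_norm.
by exists (g_ n).
Qed.

Lemma C1_approximable0 : C1_approximable set0.
Proof.
apply: (@C1_approximable_lim _ (fun _ => cst 0)) => //.
- by move=> _; exact: C1fun_cst.
- by move=> _ x; rewrite /= lexx ler01.
- by move=> x; rewrite indic0; exact: cvg_cst.
Qed.

Lemma C1_approximableC E : C1_approximable E -> C1_approximable (~` E).
Proof.
move=> [mE aE]; split; first exact: measurableC.
move=> e /aE[g [Cg g01 ge]]; exists (cst 1 - g); split.
- by apply: C1funB => //; exact: C1fun_cst.
- move=> x; have /andP[h1 h2] := g01 x.
  by rewrite -[(cst 1 - g) x]/(1 - g x) subr_ge0 h2/= gerBl.
- rewrite (le_trans _ ge)// le_eqVlt; apply/orP; left; apply/eqP.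
  apply: eq_wnorm => x.
  rewrite -[LHS]/(`|\1_(~` E) x - (1 - g x)|) -[RHS]/(`|\1_E x - g x|).
  rewrite !indicE in_setC distrC; case: (x \in E) => /=; congr `|_|; ring.
Qed.

(** The approximation is [1 - (1 - g)(1 - h)]. As all values lie in [0, 1], its error is at most the
    sum of the two errors. *)
Lemma C1_approximableU E F : C1_approximable E -> C1_approximable F ->
  C1_approximable (E `|` F).
Proof.
move=> [mE aE] [mF aF]; split; first exact: measurableU.
move=> e e0; have e20 : 0 < e / 2 by rewrite divr_gt0.
have [g [Cg g01 ge]] := aE _ e20; have [h [Ch h01 he]] := aF _ e20.
have C1g (f : Rd -> R) : C1fun f -> C1fun (cst 1 - f).
  by apply: C1funB; exact: C1fun_cst.
exists (cst 1 - (cst 1 - g) * (cst 1 - h)); split.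
- by apply: (C1g _); apply: C1funM; exact: (C1g _).
- move=> x; have := g01 x; have := h01 x.
  rewrite -[(cst 1 - (cst 1 - g) * (cst 1 - h)) x]/(1 - (1 - g x) * (1 - h x)).
  by move=> /andP[? ?] /andP[? ?]; apply/andP; split; nra.
- rewrite (@le_trans _ _ (wnorm leb w (\1_E - g) + wnorm leb w (\1_F - h))%E)//.
    have mg := C1fun_measurable Cg; have mh := C1fun_measurable Ch.
    apply: (wnorm_le wi).
    + apply: measurable_funB; first exact/measurable_indic/measurableU.
      by apply: measurable_funB => //; apply: measurable_funM; exact: measurable_funB.
    + by apply: measurable_funB => //; exact/measurable_indic.
    + by apply: measurable_funB => //; exact/measurable_indic.
    + move=> x; have := g01 x; have := h01 x.
      rewrite -[X in `|X| <= _]/(\1_(E `|` F) x - (1 - (1 - g x) * (1 - h x))).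
      rewrite -[X in _ <= `|X| + _]/(\1_E x - g x) -[X in _ <= _ + `|X|]/(\1_F x - h x).
      rewrite !indicE in_setU => /andP[h0 h1] /andP[g0 g1].
      rewrite ler_norml; have := ler_norm ((x \in E)%:R - g x); have := ler_norm ((x \in F)%:R - h x).
      have := ler_norm (-((x \in E)%:R - g x)); have := ler_norm (-((x \in F)%:R - h x)).
      rewrite !normrN.
      by case: (x \in E); case: (x \in F) => /= *; apply/andP; split; nra.
  by rewrite [leRHS](_ : _ = (e / 2)%:E + (e / 2)%:E)%E ?leeD// -EFinD; congr EFin; field.
Qed.

(** Indicators of the finite unions converge pointwise and boundedly to that of the countable union;
    one of them is within [e/2], and it is approximable within [e/2]. *)
Lemma C1_approximable_bigcup (F : (set Rd)^nat) :
  (forall n, C1_approximable (F n)) -> C1_approximable (\bigcup_n F n).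
Proof.
move=> aF; have mF n : measurable (F n) by have [] := aF n.
split; first exact: bigcup_measurable.
pose G n := \big[setU/set0]_(k < n) F k.
have aG n : C1_approximable (G n).
  by rewrite /G; elim/big_ind : _ => //; [exact: C1_approximable0|exact: C1_approximableU].
move=> e e0; have e20 : 0 < e / 2 by rewrite divr_gt0.
have [|||n hn] := @wnorm_cvg0 _ _ _ leb w wi (fun n => \1_(G n)) (\1_(\bigcup_n F n)) 1 _ _ _ _ e20.
- by move=> n; apply: measurable_indic; have [] := aG n.
- by move=> n x; have /andP[h1 h2] := indic_itv (G n) x; rewrite ger0_norm.
- move=> x; apply: cvg_near_cst; have [xF|xF] := pselect ((\bigcup_n F n) x).
    have [k _ Fkx] := xF; near=> n.
    rewrite !indicE mem_set ?mem_set// /G -bigcup_mkord; exists k => //=.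
    by near: n; exact: nbhs_infty_gt.
  apply: nearW => n; rewrite !indicE !memNset// /G -bigcup_mkord => -[k _ Fkx].
  by apply: xF; exists k.
have [_ /(_ _ e20)[g [Cg g01 ge]]] := aG n.
exists g; split => //.
rewrite (@le_trans _ _ (wnorm leb w (\1_(\bigcup_n F n) - \1_(G n)) + wnorm leb w (\1_(G n) - g))%E)//.
  have mg := C1fun_measurable Cg; have mUF : measurable (\bigcup_n F n) by exact: bigcup_measurable.
  have mGn : measurable (G n) by have [] := aG n.
  apply: (wnorm_le wi).
  + by apply: measurable_funB => //; exact/measurable_indic.
  + by apply: measurable_funB; exact/measurable_indic.
  + by apply: measurable_funB => //; exact/measurable_indic.
  + by move=> x; exact: ler_distD.
by rewrite [leRHS](_ : _ = (e / 2)%:E + (e / 2)%:E)%E ?leeD// -EFinD; congr EFin; field.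
Unshelve. all: by end_near. Qed.

Lemma C1_approximable_measurable (E : set Rd) : measurable E -> C1_approximable E.
Proof.
move=> mE.
suff : g_sigma_preimage (@rV_coord R d) `<=` C1_approximable by exact.
apply: smallest_sub.
  split; first exact: C1_approximable0.
  - by move=> B; rewrite setTD; exact: C1_approximableC.
  - exact: C1_approximable_bigcup.
rewrite -bigcup_seq/= => B [i _] [C mC <-]; rewrite setTI.
(* Second generation argument, on the real line, reducing to rays and hence to the half-spaces
   [x_i > a]. *)
have {}mC : (@RGenOInfty.G R).-sigma.-measurable C by rewrite -RGenOInfty.measurableE.
suff : <<s @RGenOInfty.G R >> `<=` [set C | C1_approximable (@rV_coord R d i @^-1` C)].
  exact.
apply: smallest_sub.
  split => /=; first by rewrite preimage_set0; exact: C1_approximable0.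
  - by move=> A; rewrite setTD; exact: C1_approximableC.
  - by move=> F aF; rewrite preimage_bigcup; exact: C1_approximable_bigcup.
move=> _ [a ->] /=.
apply: (@C1_approximable_lim _ (fun n x => step (n%:R * (x ord0 i - a)))).
- rewrite -[X in measurable X]setTI; apply: measurable_rV_coord => //.
- move=> n; have dl (t : R) : is_derive t (1 : R) (fun t : R => n%:R * (t - a)) n%:R.
    have := is_deriveZ n%:R (is_deriveB (is_derive_id t (1 : R)) (is_derive_cst a t (1 : R))).
    by move=> h; apply: (is_derive_eq h); rewrite subr0 [_ *: _]mulr1.
  have cl : continuous (fun t : R => n%:R * (t - a)).
    by move=> t; apply: cvgM; [exact: cvg_cst|apply: cvgB; [exact: cvg_id|exact: cvg_cst]].
  apply: (@C1fun_coord _ _ (fun t => step (n%:R * (t - a)))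
    (fun t => ((1 + sqpos (n%:R * (t - a))) ^- 2 * (2 * Num.max 0 (n%:R * (t - a)))) * n%:R)).
    move=> t; exact: (is_derive1_comp (is_derive_step _) (dl t)).
  have cds : continuous ((fun t : R => (1 + sqpos t) ^- 2 * (2 * Num.max 0 t)) \o
      (fun t : R => n%:R * (t - a))).
    by move=> t; apply: continuous_comp; [exact: cl|exact: continuous_dstep].
  by move=> t; apply: cvgM; [exact: cds|exact: cvg_cst].
- by move=> n x; exact: step_itv.
- move=> x; have := @cvg_step R (x ord0 i - a); rewrite subr_gt0.
  rewrite indicE (_ : (x \in _) = (a < x ord0 i))//.
  by apply/idP/idP; rewrite inE /= /rV_coord in_itv/= andbT.
Qed.

(** The norm is the integral of [w] against its sign. The sign is replaced by [(2 g - 1) chi], with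
    [g] close to the indicator of [w > 0] and [chi] a wide cutoff, at a cost that vanishes in the
    weighted norm. *)
Lemma norm_le_of_C1_dual (M : R) :
  (forall psi, C1fun psi -> bounded_support psi -> (forall x, `|psi x| <= 1) ->
    (\int[leb]_x (w x * psi x)%:E <= M%:E)%E) ->
  (\int[leb]_x (`|w x|)%:E <= M%:E)%E.
Proof.
move=> hM; apply/lee_addgt0Pr => e e0.
(* Three shares: the error of [g] counts twice, because of the factor 2 in [2 g - 1], and the cutoff
   takes the third. *)
have e30 : 0 < e / 3 by rewrite divr_gt0.
have mw : measurable_fun setT w by apply/measurable_EFinP; case/integrableP: wi.
pose E := [set x | 0 < w x].
have mE : measurable E.
  rewrite (_ : E = w @^-1` `]0, +oo[%classic); last first.
    by apply/seteqP; split => x /=; rewrite in_itv/= andbT.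
  by rewrite -[X in measurable X]setTI; exact: mw.
have [_ /(_ _ e30)[g [Cg g01 ge]]] := C1_approximable_measurable mE.
have mg := C1fun_measurable Cg.
pose chi n (x : Rd) := cutoff (n.+1%:R^-1 *: x).
have Cchi n : C1fun (chi n) by exact: C1fun_scale (C1fun_cutoff _).
have chi01 n x : 0 <= chi n x <= 1 by exact: cutoff_itv.
have chi1 x : chi n x @[n --> \oo] --> (cst 1 x : R).
  rewrite /= -(@cutoff0 R d).
  have c0 : (fun n => n.+1%:R^-1 *: x) @ \oo --> (0 : Rd).
    rewrite -(scale0r x); apply: cvgZl; exact: cvg_harmonic.
  have [cc _ _] := (@C1fun_cutoff R d).
  exact: (cvg_comp _ _ c0 (cc 0)).
have [||n hn] := @wnorm_cvg0 _ _ _ leb w wi chi (cst 1) 1 _ _ chi1 _ e30.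
- by move=> n; exact: C1fun_measurable.
- by move=> n x; have /andP[h1 h2] := chi01 n x; rewrite ger0_norm.
pose psi := (cst 2 * g - cst 1) * chi n.
(* The sign of [w], with value -1 where [w] vanishes, which does not affect the integral. *)
pose s : Rd -> R := cst 2 * \1_E - cst 1.
have Cpsi : C1fun psi.
  apply: C1funM => //; apply: C1funB; last exact: C1fun_cst.
  by apply: C1funM => //; exact: C1fun_cst.
have mpsi := C1fun_measurable Cpsi.
have mi : measurable_fun setT (\1_E : Rd -> R) by exact: measurable_indic.
have ms : measurable_fun setT s.
  by apply: measurable_funB => //; exact: measurable_funM.
have mchi := C1fun_measurable (Cchi n).
have psi1 x : `|psi x| <= 1.
  rewrite -[psi x]/((2 * g x - 1) * chi n x).
  have /andP[g0 g1] := g01 x; have /andP[c0 c1] := chi01 n x.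
  by rewrite ler_norml; apply/andP; split; nra.
have s1 x : `|s x| <= 1.
  rewrite -[s x]/(2 * \1_E x - 1) indicE.
  by rewrite ler_norml; case: (_ \in _) => /=; apply/andP; split; lra.
have -> : (\int[leb]_x (`|w x|)%:E = \int[leb]_x (w x * s x)%:E)%E.
  apply: eq_integral => x _; congr EFin.
  rewrite -[s x]/(2 * \1_E x - 1) indicE.
  have [w0|w0] := ltP 0 (w x).
    by rewrite mem_set//= gtr0_norm//; ring.
  by rewrite memNset/= ?ler0_norm//; [ring|apply/negP; rewrite -leNgt].
apply: (le_trans (integral_le_wnorm wi ms mpsi s1 psi1)).
apply: leeD.
  apply: hM => //.
  have [M' hM'] := @bounded_support_cutoff R d.
  exists (n.+1%:R * M') => x hx.
  rewrite -[psi x]/((2 * g x - 1) * chi n x) /chi hM' ?mulr0//.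
  by rewrite normrZ ger0_norm ?invr_ge0// mulrC ltr_pdivlMr// mulrC.
pose q : Rd -> R := cst 2 * (\1_E - g); pose r : Rd -> R := cst 1 - chi n.
have m2 : measurable_fun setT q.
  by apply: measurable_funM => //; exact: measurable_funB.
apply: (@le_trans _ _ (wnorm leb w q + wnorm leb w r)%E).
  apply: (wnorm_le wi) => //; first exact: measurable_funB.
    exact: measurable_funB.
  move=> x; rewrite -[X in `|X| <= _]/(2 * \1_E x - 1 - (2 * g x - 1) * chi n x).
  rewrite -[X in _ <= `|X| + _]/(2 * (\1_E x - g x)) -[X in _ <= _ + `|X|]/(1 - chi n x).
  (* This separates the error of [g] from that of the cutoff, the latter with a factor of absolute
     value at most 1. *)
  have -> : 2 * \1_E x - 1 - (2 * g x - 1) * chi n x =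
    2 * (\1_E x - g x) + (2 * g x - 1) * (1 - chi n x) by ring.
  rewrite (le_trans (ler_normD _ _))// lerD// normrM ler_piMl//.
  have /andP[g0 g1] := g01 x.
  by rewrite ler_norml; apply/andP; split; lra.
have -> : e%:E = ((e / 3)%:E + (e / 3)%:E + (e / 3)%:E)%E.
  by rewrite -!EFinD; congr EFin; field.
apply: leeD => //.
have -> : wnorm leb w q =
    (wnorm leb w (\1_E - g) + wnorm leb w (\1_E - g))%E.
  have m0 : measurable_fun setT (fun x => (`|w x * (\1_E - g) x|)%:E).
    apply/measurable_EFinP; apply: measurableT_comp => //.
    by apply: measurable_funM => //; exact: measurable_funB.
  rewrite /wnorm -ge0_integralD//.
  apply: eq_integral => x _; rewrite -EFinD; congr EFin.
  rewrite -[q x]/(2 * (\1_E - g) x) mulrCA normrM.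
  by rewrite ger0_norm// mulr_natl.
exact: leeD.
Qed.

End norming.

(** * Total variation and translations *)

Section total_variation_translation.
Context {R : realType} (d : nat).
Local Notation Rd := 'rV[R]_d.
Local Notation leb := (@lebesgue_Rd R d).

Lemma L1P (u : Rd -> R) : L1 u <-> leb.-integrable setT (EFin \o u).
Proof.
split.
  by move=> [mu iu]; apply/integrableP; split => //; exact/measurable_EFinP.
by move=> /integrableP[mu iu]; split => //; exact/measurable_EFinP.
Qed.

Lemma measurable_fun_translate (u : Rd -> R) z :
  measurable_fun setT u -> measurable_fun setT (fun x : Rd => u (x + z)).
Proof. by move=> mu; exact: (measurableT_comp mu (measurable_addr_rV z)). Qed.

Lemma measurable_fun_translate_e (u : Rd -> \bar R) z :
  measurable_fun setT u -> measurable_fun setT (fun x : Rd => u (x + z)).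
Proof. by move=> mu; exact: (measurableT_comp mu (measurable_addr_rV z)). Qed.

Lemma L1_translate (u : Rd -> R) z : L1 u -> L1 (fun x => u (x + z)).
Proof.
move=> [mu iu]; split; first exact: measurable_fun_translate.
rewrite (ge0_integral_translate z (f := fun x => (`|u x|)%:E))//.
by apply/measurable_EFinP; exact: measurableT_comp.
Qed.

Lemma L1B (u v : Rd -> R) : L1 u -> L1 v -> L1 (u - v).
Proof.
move=> /L1P iu /L1P iv; apply/L1P.
rewrite (_ : EFin \o _ = (EFin \o u) \- (EFin \o v))%E; first exact: integrableB.
by apply/funext => x /=; rewrite EFinB.
Qed.

Lemma Rintegral_translate z (f : Rd -> R) : measurable_fun setT f ->
  \int[leb]_x f (x + z) = \int[leb]_x f x.
Proof.
move=> mf; rewrite /Rintegral.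
by rewrite (integral_translate z (f := EFin \o f))//; exact/measurable_EFinP.
Qed.

Lemma test_field_basis (psi : Rd -> R) i : C1fun psi -> bounded_support psi ->
  (forall x, `|psi x| <= 1) ->
  test_field (fun x => psi x *: basis_vec i) /\
  divergence (fun x => psi x *: basis_vec i) = (fun x => 'D_(basis_vec i) psi x).
Proof.
move=> [cpsi dpsi Dpsi] bpsi psi1.
have E j : (fun y => (psi y *: basis_vec i) ord0 j) = if j == i then psi else cst 0.
  apply/funext => y; rewrite !mxE eqxx/=; case: ifP => _; first by rewrite mulr1.
  by rewrite mulr0.
split; last first.
  apply/funext => x; rewrite /divergence (bigD1 i)//= E eqxx big1 ?addr0//.
  by move=> j ji; rewrite E (negbTE ji) derive_cst.
split.
- by move=> k j x; rewrite E; case: ifP => _ //; exact: derivable_cst.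
- move=> k j; rewrite E; case: ifP => _; first exact: Dpsi.
  rewrite (_ : (fun x => 'D_(basis_vec k) _ x) = cst 0); first exact: cst_continuous.
  by apply/funext => x; rewrite derive_cst.
- apply/bounded_supportP; have [M h] := bpsi; exists M => x /h ->.
  by rewrite scale0r.
- move=> x; rewrite (bigD1 i)//= big1 ?addr0.
    rewrite -[(psi x *: basis_vec i) ord0 i]/((fun y => (psi y *: basis_vec i) ord0 i) x).
    by rewrite E eqxx -real_normK ?num_real// exprn_ile1.
  move=> j ji; rewrite -[(psi x *: basis_vec i) ord0 j]/((fun y => (psi y *: basis_vec i) ord0 j) x).
  by rewrite E (negbTE ji) expr0n.
Qed.

Lemma integral_divergence_le (u : Rd -> R) phi : test_field phi ->
  (\int[leb]_x (u x * divergence phi x)%:E <= total_variation u)%E.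
Proof. by move=> tphi; apply: ereal_sup_ubound; exists phi. Qed.

Lemma total_variation_nonneg (u : Rd -> R) : (0 <= total_variation u)%E.
Proof.
have t0 : test_field (cst (0 : Rd)).
  have E (j : 'I_d) : (fun y : Rd => (cst (0 : Rd) y) ord0 j) = cst (0 : R).
    by apply/funext => y; rewrite mxE.
  split.
  - by move=> k j x; rewrite E; exact: derivable_cst.
  - move=> k j; rewrite E (_ : (fun x => 'D_(basis_vec k) _ x) = cst 0).
      exact: cst_continuous.
    by apply/funext => x; rewrite derive_cst.
  - by apply/bounded_supportP; exists 0.
  - by move=> x; rewrite big1 ?ler01// => j _; rewrite mxE expr0n.
apply: le_trans (integral_divergence_le u t0).
rewrite integral0_eq// => x _; congr EFin.
rewrite /divergence big1 ?mulr0// => i _.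
rewrite (_ : (fun y => _) = cst (0 : R)) ?derive_cst//.
by apply/funext => y; rewrite mxE.
Qed.

Section line_integral.
Variables (u psi : Rd -> R) (i : 'I_d).
Hypotheses (L1u : L1 u) (C1psi : C1fun psi) (bpsi : bounded_support psi).
Let iu : leb.-integrable setT (EFin \o u). Proof. exact/L1P. Qed.

Lemma integrable_mulr_C1 z :
  leb.-integrable setT (fun x => (u x * psi (x + z))%:E).
Proof.
have [cpsi _ _] := C1psi.
have [K K0 hK] := bounded_of_bounded_support cpsi bpsi.
apply: (integrable_mulr_bounded iu (K := K)) => //.
by apply: measurable_fun_translate; exact: C1fun_measurable.
Qed.

Lemma integrable_mulr_derive_C1 z :
  leb.-integrable setT (fun x => (u x * 'D_(basis_vec i) psi (x + z))%:E).
Proof.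
have [_ _ /(_ i) Dpsi] := C1psi.
have [K K0 hK] := bounded_of_bounded_support Dpsi (bounded_support_derive (basis_vec i) bpsi).
apply: (integrable_mulr_bounded iu (K := K)) => //.
apply: (@measurable_fun_translate (fun x => 'D_(basis_vec i) psi x)).
exact: continuous_measurable_rV.
Qed.

(** Differentiation under the integral sign, dominated by [K |u|] with [K] a bound for the partial
    derivative of [psi]. *)
Lemma is_derive_integral_line (t : R) :
  is_derive t (1 : R) (fun s : R => \int[leb]_x (u x * psi (x + s *: basis_vec i)))
    (\int[leb]_x (u x * 'D_(basis_vec i) psi (x + t *: basis_vec i))).
Proof.
have [_ dpsi /(_ i) Dpsi] := C1psi.
have [K K0 hK] := bounded_of_bounded_support Dpsi (bounded_support_derive (basis_vec i) bpsi).
pose f (s : R) (x : Rd) := u x * psi (x + s *: basis_vec i).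
have df x s : is_derive s (1 : R) (f ^~ x) (u x * 'D_(basis_vec i) psi (x + s *: basis_vec i)).
  exact: (is_deriveZ (u x) (is_derive_line (dpsi i (x + s *: basis_vec i)))).
have dfE x s : partial1of2 f s x = u x * 'D_(basis_vec i) psi (x + s *: basis_vec i).
  by rewrite partial1of2E; have [_ <-] := df x s.
pose G (x : Rd) := K * `|u x|.
have tI : (`]t - 1, t + 1[ : set R)%classic t.
  by rewrite /= in_itv/= ltrDl ltrBlDr ltrDl ltr01.
have intf s : (`]t - 1, t + 1[ : set R)%classic s -> leb.-integrable setT (EFin \o f s).
  by move=> _; exact: integrable_mulr_C1.
have derf s x : (`]t - 1, t + 1[ : set R)%classic s -> [set: Rd] x -> derivable (f ^~ x) s (1 : R).
  by move=> _ _; have [] := df x s.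
have G0 x : 0 <= G x by rewrite /G mulr_ge0.
have iG : leb.-integrable setT (EFin \o G).
  rewrite (_ : EFin \o G = (fun x => K%:E * (`|u x|)%:E)%E).
    by apply: integrableZl => //; exact: integrable_norm.
  by apply/funext => x /=; rewrite EFinM.
have Gub s x : (`]t - 1, t + 1[ : set R)%classic s -> [set: Rd] x -> `|partial1of2 f s x| <= G x.
  by move=> _ _; rewrite dfE normrM mulrC ler_wpM2r.
split.
  exact: (derivable_under_integral measurableT tI intf derf G0 iG Gub).
rewrite -derive1E (differentiation_under_integral measurableT tI intf derf G0 iG Gub).
by apply: eq_Rintegral => x _; rewrite dfE.
Qed.

End line_integral.

Lemma Rintegral_le_norm (w psi : Rd -> R) (K : R) : L1 w -> measurable_fun setT psi ->
  (forall x, `|psi x| <= K) ->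
  `|\int[leb]_x (w x * psi x)| <= K * \int[leb]_x `|w x|.
Proof.
move=> /L1P iw mpsi psiK.
have iwp := integrable_mulr_bounded iw mpsi psiK.
rewrite (le_trans (le_normr_Rintegral _ iwp))//.
rewrite -RintegralZl//; last exact: integrable_norm.
apply: le_Rintegral => //.
- exact: integrable_norm.
- rewrite (_ : EFin \o _ = (fun x => K%:E * (`|w x|)%:E)%E).
    by apply: integrableZl => //; exact: integrable_norm.
  by apply/funext => x /=; rewrite EFinM.
- by move=> x _; rewrite normrM mulrC ler_wpM2r.
Qed.

Lemma Rintegral_shift (u psi : Rd -> R) z : measurable_fun setT u ->
  measurable_fun setT psi ->
  \int[leb]_x (u x * psi (x + z)) = \int[leb]_x (u (x - z) * psi x).
Proof.
move=> mu mpsi; rewrite -(@Rintegral_translate z (fun x => u (x - z) * psi x)).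
  by apply: eq_Rintegral => x _; rewrite addrK.
by apply: measurable_funM => //; exact: measurable_fun_translate.
Qed.

(** Discrete integration by parts: translation invariance moves the increment from [psi] to [u],
    with the opposite shift. *)
Lemma Rintegral_shiftB (u psi : Rd -> R) z (K : R) : L1 u ->
  measurable_fun setT psi -> (forall x, `|psi x| <= K) ->
  \int[leb]_x (u x * psi (x + z)) - \int[leb]_x (u x * psi x) =
  \int[leb]_x ((u (x - z) - u x) * psi x).
Proof.
move=> Lu mpsi psiK; have [mu _] := Lu; rewrite Rintegral_shift//.
have h1 := integrable_mulr_bounded ((L1P _).1 (L1_translate (- z) Lu)) mpsi psiK.
have h2 := integrable_mulr_bounded ((L1P _).1 Lu) mpsi psiK.
by rewrite -RintegralB//; apply: eq_Rintegral => x _; rewrite mulrBl.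
Qed.

Lemma L1_Rintegral (w : Rd -> R) : L1 w ->
  ((\int[leb]_x `|w x|)%:E = \int[leb]_x (`|w x|)%:E)%E.
Proof.
move=> Lw; rewrite /Rintegral fineK// ge0_fin_numE; first by case: Lw.
exact: integral_ge0.
Qed.

Lemma translate_coord_le (u : Rd -> R) : L1 u -> (total_variation u < +oo)%E ->
  forall i t, (\int[leb]_x (`|u (x + t *: basis_vec i) - u x|)%:E <=
    (fine (total_variation u) * `|t|)%:E)%E.
Proof.
move=> Lu tvu i t; have [mu _] := Lu.
have Lw : L1 (fun x => u (x + t *: basis_vec i) - u x).
  exact: (L1B (L1_translate _ Lu) Lu).
have tvE : total_variation u = (fine (total_variation u))%:E.
  by rewrite fineK// ge0_fin_numE// total_variation_nonneg.
apply: (norm_le_of_C1_dual ((L1P _).1 Lw)) => psi Cpsi bpsi psi1.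
have mpsi := C1fun_measurable Cpsi.
pose F (s : R) := \int[leb]_x (u x * psi (x + s *: basis_vec i)).
have dF s := is_derive_integral_line i Lu Cpsi bpsi s.
(* A translate of a test function is a test function, so the bound by the total variation is uniform
   along the line. *)
have F't (p : Rd -> R) z : C1fun p -> bounded_support p -> (forall x, `|p x| <= 1) ->
  \int[leb]_x (u x * 'D_(basis_vec i) p (x + z)) <= fine (total_variation u).
  move=> Cp bp p1.
  have [tf dE] := test_field_basis i (C1fun_translate z Cp)
    (bounded_support_translate z bp) (fun x => p1 (x + z)).
  rewrite -lee_fin -tvE /Rintegral fineK; last first.
    exact/integrable_fin_num/integrable_mulr_derive_C1.
  apply: le_trans (integral_divergence_le u tf); rewrite dE le_eqVlt.
  apply/orP; left; apply/eqP/eq_integral => x _; congr (_ * _)%:E.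
  by rewrite derive_translate.
have F'b s : `|\int[leb]_x (u x * 'D_(basis_vec i) psi (x + s *: basis_vec i))| <=
    fine (total_variation u).
  (* The lower bound is the upper bound for the opposite test function. *)
  rewrite ler_norml F't// andbT lerNl.
  have Cn : C1fun (cst 0 - psi) by apply: C1funB => //; exact: C1fun_cst.
  have bn : bounded_support (cst 0 - psi).
    have [M h] := bpsi; exists M => x /h hx.
    by rewrite -[LHS]/(0 - psi x) hx subr0.
  have n1 x : `|(cst 0 - psi) x| <= 1.
    by rewrite -[(cst 0 - psi) x]/(0 - psi x) sub0r normrN.
  apply: le_trans (F't _ (s *: basis_vec i) Cn bn n1).
  rewrite le_eqVlt; apply/orP; left; apply/eqP.
  rewrite -mulN1r -RintegralZl//; last exact: integrable_mulr_derive_C1.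
  have [_ dpsi _] := Cpsi.
  apply: eq_Rintegral => x _; rewrite deriveB ?derive_cst//.
  by rewrite sub0r mulrN mulN1r.
(* Evaluated at [- t], since the shift changes sign when it passes to [u]. *)
have := lipschitz_of_is_derive dF F'b 0 (- t).
rewrite subr0 normrN /F /=.
have -> : (fun x => u x * psi (x + 0 *: basis_vec i)) = (fun x => u x * psi x).
  by apply/funext => x; rewrite scale0r addr0.
rewrite scaleNr (Rintegral_shiftB _ Lu mpsi psi1).
rewrite opprK => /(le_trans (ler_norm _)); rewrite -lee_fin.
apply: le_trans; rewrite /Rintegral fineK//.
exact/integrable_fin_num/(integrable_mulr_bounded ((L1P _).1 Lw) mpsi psi1).
Qed.

Lemma translate_le (u : Rd -> R) : L1 u -> (total_variation u < +oo)%E ->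
  forall z, (\int[leb]_x (`|u (x + z) - u x|)%:E <=
    (fine (total_variation u) * \sum_i `|z ord0 i|)%:E)%E.
Proof.
move=> Lu tvu; have [mu _] := Lu.
have m2 (f : Rd -> R) : measurable_fun setT f ->
    measurable_fun setT (fun x => (`|f x|)%:E).
  by move=> mf; apply/measurable_EFinP; exact: measurableT_comp.
have muz z : measurable_fun setT (fun x : Rd => u (x + z)) by exact: measurable_fun_translate.
apply: (@rV_coord_ind _ _ (fun z a => (\int[leb]_x (`|u (x + z)%R - u x|)%:E <= a%:E)%E)).
- by rewrite integral0_eq// => x _; rewrite addr0 subrr normr0.
- move=> z w a b za wb.
  rewrite addrC EFinD.
  apply: le_trans (leeD za wb).
  have mw : measurable_fun setT (fun x : Rd => u (x + w) - u x) by exact: measurable_funB.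
  have mz : measurable_fun setT (fun x : Rd => u (x + z) - u x) by exact: measurable_funB.
  rewrite -(ge0_integral_translate w (m2 _ mz))// -ge0_integralD//; last 2 first.
  + exact: (measurable_fun_translate_e w (m2 _ mz)).
  + exact: m2.
  apply: ge0_le_integral => //.
  + by apply: m2; exact: measurable_funB.
  + apply: emeasurable_funD; [exact: (measurable_fun_translate_e w (m2 _ mz))|exact: m2].
  + by move=> x _; rewrite -EFinD lee_fin addrA ler_distD.
- by move=> i t; exact: translate_coord_le.
Qed.

(** For each component of a test field, [int u d_i phi_i] is the derivative at 0 of a function whose
    increments from 0 are at most [C |t|], hence is at most [C]. Adding the components gives the
    factor [d]. *)
Lemma total_variation_le_of_translate (u : Rd -> R) (C : R) : L1 u ->
  (forall i t, (\int[leb]_x (`|u (x + t *: basis_vec i) - u x|)%:E <= (C * `|t|)%:E)%E) ->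
  (total_variation u <= (d%:R * C)%:E)%E.
Proof.
move=> Lu uC; have [mu _] := Lu.
apply: ub_ereal_sup => _ [phi tphi <-].
have [dphi Dphi cphi phi1] := tphi.
have /bounded_supportP[M hM] := cphi.
have bi i : bounded_support (fun x => phi x ord0 i).
  by exists M => x /hM ->; rewrite mxE.
have Ci i : C1fun (fun x => phi x ord0 i).
  by apply: C1fun_of_partials.
have phii i x : `|phi x ord0 i| <= 1.
  rewrite -[leRHS]sqrtr1 -sqrtr_sqr ler_wsqrtr//.
  apply: le_trans (phi1 x); rewrite (bigD1 i)//= lerDl sumr_ge0// => j _.
  exact: sqr_ge0.
pose D i x := u x * 'D_(basis_vec i) (fun y => phi y ord0 i) x.
have iD i : leb.-integrable setT (fun x => (D i x)%:E).
  have := integrable_mulr_derive_C1 i Lu (Ci i) (bi i) 0.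
  by apply: eq_integrable => // x _; rewrite addr0.
have DC i : \int[leb]_x (D i x) <= C.
  pose F (s : R) := \int[leb]_x (u x * phi (x + s *: basis_vec i) ord0 i).
  have [dF F0] := is_derive_integral_line i Lu (Ci i) (bi i) 0.
  have -> : \int[leb]_x (D i x) = 'D_(1 : R) F (0 : R).
    rewrite F0; apply: eq_Rintegral => x _; by rewrite scale0r addr0.
  have mphi := C1fun_measurable (Ci i).
  have FC t : `|F t - F 0| <= C * `|t|.
    rewrite /F; have -> : (fun x => u x * phi (x + 0 *: basis_vec i) ord0 i) =
        (fun x => u x * phi x ord0 i).
      by apply/funext => x; rewrite scale0r addr0.
    have := Rintegral_shiftB (t *: basis_vec i) Lu mphi (phii i) => /= ->.
    have Lw : L1 (fun x => u (x - t *: basis_vec i) - u x).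
      exact: (L1B (L1_translate _ Lu) Lu).
    rewrite (le_trans (Rintegral_le_norm Lw mphi (phii i)))// mul1r.
    by rewrite -lee_fin L1_Rintegral// -scaleNr -(normrN t).
  apply: (limr_le dF); near=> h.
  have h0 : h != 0 by near: h; exact: nbhs_dnbhs_neq.
  rewrite /= addr0 [h *: 1]mulr1 (le_trans (ler_norm _))// normrM normfV.
  by rewrite mulrC ler_pdivrMr ?normr_gt0// FC.
have -> : (\int[leb]_x (u x * divergence phi x)%:E = \int[leb]_x (\sum_i (D i x)%:E))%E.
  by apply: eq_integral => x _; rewrite /divergence mulr_sumr sumEFin.
rewrite integral_sum//.
apply: (@le_trans _ _ (\sum_(i < d) C%:E)%E).
  apply: lee_sum => i _; rewrite -(fineK (integrable_fin_num _ (iD i)))// lee_fin.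
  exact: DC.
by rewrite sumEFin sumr_const card_ord mulr_natl.
Unshelve. all: by end_near. Qed.

End total_variation_translation.

(** * L^1 compactness *)

Section L1_fast_cauchy.
Context d (T : measurableType d) (R : realType) (mu : {measure set T -> \bar R}).
Variable v : nat -> T -> R.
Let eps (k : nat) : R := 1 / (2 ^ (k + 1))%:R.
Hypothesis mv : forall n, measurable_fun setT (v n).
Hypothesis vcauchy : forall k l, (k <= l)%N ->
  (\int[mu]_x (`|v l x - v k x|)%:E <= (eps k)%:E)%E.

Let mvv k l : measurable_fun setT (fun x => (`|v l x - v k x|)%:E).
Proof.
by apply/measurable_EFinP; apply: measurableT_comp => //; exact: measurable_funB.
Qed.

(** The series of [|v (k+1) - v k|] has integral at most the sum of the [eps k], so it is finite
    a.e. and the telescoping series converges absolutely there. *)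
Lemma ae_cvg_of_fast_cauchy : {ae mu, forall x, cvgn (v ^~ x)}.
Proof.
pose h x := (\sum_(k <oo) (`|v k.+1 x - v k x|)%:E)%E.
have mh : measurable_fun setT h.
  by apply: ge0_emeasurable_sum => // k x _; rewrite lee_fin.
have h0 x : (0 <= h x)%E by apply: nneseries_ge0 => k _ _; rewrite lee_fin.
have ih : mu.-integrable setT h.
  apply/integrableP; split => //.
  rewrite (eq_integral h); last by move=> x _; rewrite gee0_abs.
  rewrite integral_nneseries//.
  apply: (@le_lt_trans _ _ (\sum_(k <oo) (eps k)%:E)%E).
    apply: lee_nneseries => [k _ _|k _]; first by apply: integral_ge0 => x _; rewrite lee_fin.
    exact: (vcauchy (leqnSn k)).
  have /cvg_lim -> // := @cvg_geometric_eseries_half R 1 0.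
  by rewrite ltry.
have := integrable_ae measurableT ih; apply: filterS => x /(_ I) hx.
have cs : cvgn (series (telescope (v ^~ x))).
  apply: normed_cvg; apply: nondecreasing_is_cvgn.
    by apply: nondecreasing_series => n _ _ /=.
  exists (fine (h x)) => _ [n _ <-].
  rewrite -lee_fin fineK// /h -sumEFin.
  by apply: (le_trans _ (nneseries_lim_ge n _)) => //; rewrite big_mkord.
move/cvg_ex : cs => [l cl]; apply/cvg_ex; exists (v 0%N x + l).
rewrite (_ : v ^~ x = (fun n => v 0%N x + series (telescope (v ^~ x)) n)).
  by apply: cvgD => //; exact: cvg_cst.
by apply/funext => n; exact: (eq_sum_telescope (v ^~ x)).
Qed.

(** The a.e. limit inherits the Cauchy bound through Fatou's lemma applied to [|v k - v l|] as [l]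
    grows. *)
Lemma L1_limit_of_fast_cauchy : exists g : T -> R, [/\ measurable_fun setT g,
  {ae mu, forall x, v n x @[n --> \oo] --> g x} &
  forall k, (\int[mu]_x (`|v k x - g x|)%:E <= (eps k)%:E)%E].
Proof.
(* The upper limit is measurable everywhere and is the limit wherever that exists; [fine] sends
   infinite values to 0. *)
pose g x := fine (limn_esup (fun n => (v n x)%:E)).
have mg : measurable_fun setT g.
  apply: measurableT_comp => //.
  by apply: measurable_fun_limn_esup => n; exact/measurable_EFinP.
have cg : {ae mu, forall x, v n x @[n --> \oo] --> g x}.
  apply: filterS ae_cvg_of_fast_cauchy => x /cvg_ex[l cl].
  suff -> : g x = l by [].
  have cl' : (v n x)%:E @[n --> \oo] --> l%:E by apply/cvg_EFin => //; exact: nearW.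
  rewrite /g is_cvg_limn_esupE; last by apply/cvg_ex; exists l%:E.
  by rewrite (cvg_lim _ cl').
exists g; split => // k.
have mk l : measurable_fun setT (fun x => (`|v k x - v l x|)%:E) by exact: mvv.
have mF : measurable_fun setT (fun x => limn_einf (fun l => (`|v k x - v l x|)%:E)).
  apply: measurableT_comp => //; apply: measurable_fun_limn_esup => n.
  exact: measurableT_comp.
apply: (@le_trans _ _ (\int[mu]_x limn_einf (fun l => (`|v k x - v l x|)%:E))%E).
  apply: ae_ge0_le_integral => //.
  - by apply/measurable_EFinP; apply: measurableT_comp => //; exact: measurable_funB.
  - move=> x _; rewrite limn_einf_lim; apply: lime_ge; first exact: is_cvg_einfs.
    apply: nearW => n; apply: le_ereal_inf_tmp => _ [l _ <-].
    by rewrite lee_fin.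
  - apply: filterS cg => x cx _.
    have c' : (`|v k x - v l x|)%:E @[l --> \oo] --> (`|v k x - g x|)%:E.
      apply/cvg_EFin; first exact: nearW.
      by apply: cvg_norm; apply: cvgB => //; exact: cvg_cst.
    rewrite is_cvg_limn_einfE; last by apply/cvg_ex; exists (`|v k x - g x|)%:E.
    by rewrite (cvg_lim _ c').
have m0 n x : setT x -> (0 <= (`|v k x - v n x|)%:E)%E by rewrite lee_fin.
apply: (le_trans (fatou mu measurableT mk m0)).
rewrite (le_trans (limn_einf_sup _))//.
rewrite limn_esup_lim; apply: lime_le; first exact: is_cvg_esups.
near=> n; apply: ub_ereal_sup => _ [l /= nl <-].
under eq_integral do rewrite distrC.
apply: vcauchy; apply: leq_trans nl.
by near: n; exact: nbhs_infty_ge.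
Unshelve. all: by end_near. Qed.

End L1_fast_cauchy.

(* Working along an ultrafilter makes every bounded real sequence converge and so
   replaces the diagonal extraction of a subsequence. *)
Lemma ultra_bounded_cauchy {R : realType} (U : set_system nat) (a : nat -> R) :
  UltraFilter U -> (forall n, `|a n| <= 1) -> forall e, 0 < e ->
  exists2 A, U A & forall n m, A n -> A m -> `|a n - a m| <= e.
Proof.
move=> UU a1 e e0.
have Fs : (a @ U) `[-1, 1]%classic.
  have h n : `[(-1 : R), 1]%classic (a n) by rewrite /= in_itv/= -ler_norml.
  exact: filterE h.
have [p [_ clp]] := @segment_compact R (-1) 1 (a @ U) _ Fs.
have e20 : 0 < e / 2 by rewrite divr_gt0.
(* An ultrafilter contains this set or its complement; the complement would keep the sequence away
   from its cluster point [p]. *)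
have [h|h] := @in_ultra_setVsetC _ U [set n | `|p - a n| < e / 2] UU.
  exists [set n | `|p - a n| < e / 2] => // n m /= hn hm.
  by rewrite (le_trans (ler_distD p _ _))// [leRHS](splitr e) lerD// ltW// distrC.
exfalso.
have h' : (a @ U) [set y | ~ `|p - y| < e / 2] by [].
have [y [/= yn]] := clp _ _ h' (nbhsx_ballx p _ e20).
by rewrite -ball_normE/=.
Qed.

(** * Averages over small cubes *)

Section averaging.
Context {R : realType} (d : nat).
Local Notation Rd := 'rV[R]_d.
Local Notation leb := (@lebesgue_Rd R d).
Variable e : R.
Hypothesis e0 : 0 < e.
Local Notation B := (cube (0 : Rd) e).
Let c : R := fine (leb B).

Let cE : c%:E = leb B.
Proof.
by rewrite /c fineK// ge0_fin_numE ?measure_ge0//; exact: lebesgue_Rd_cube_lty.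
Qed.

Let iB : leb.-integrable setT (EFin \o (\1_B : Rd -> R)).
Proof.
apply/integrableP; split.
  by apply/measurable_EFinP/measurable_indic; exact: measurable_cube.
rewrite (eq_integral (fun x => (\1_B x)%:E)); last first.
  by move=> x _ /=; rewrite ger0_norm.
rewrite integral_indic//; last exact: measurable_cube.
by rewrite setIT; exact: lebesgue_Rd_cube_lty.
Qed.

Let mB : measurable_fun setT (\1_B : Rd -> R).
Proof. by apply/measurable_indic; exact: measurable_cube. Qed.

Let B1 x : `|\1_B x : R| <= 1.
Proof. by rewrite indicE; case: (_ \in _); rewrite ?normr1 ?normr0. Qed.

(** Not divided by the volume [c] of the cube; accordingly it is compared with [c * v]. *)
Definition averaging (v : Rd -> R) (x : Rd) : R :=
  \int[leb]_z (v (z + x) * \1_B z).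

Lemma averaging_le v x : L1 v -> `|averaging v x| <= \int[leb]_z `|v z|.
Proof.
move=> Lv; have [mv _] := Lv.
have := Rintegral_le_norm (L1_translate x Lv) mB B1; rewrite mul1r => h.
rewrite (le_trans h)// (@Rintegral_translate _ _ x (fun z => `|v z|))//.
exact: measurableT_comp.
Qed.

(** After a shift by [y] the difference is controlled by the translation estimate for [x - y]. The
    Lipschitz constant does not depend on the function. *)
Lemma averaging_dist v C : L1 v ->
  (forall z, (\int[leb]_x (`|v (x + z) - v x|)%:E <= (C * `|z|)%:E)%E) ->
  forall x y, `|averaging v x - averaging v y| <= C * `|x - y|.
Proof.
move=> Lv vC x y; have [mv _] := Lv.
have Lx := L1_translate x Lv; have Ly := L1_translate y Lv.
rewrite /averaging -RintegralB//; last 2 first.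
- exact: (integrable_mulr_bounded ((L1P _).1 Lx) mB B1).
- exact: (integrable_mulr_bounded ((L1P _).1 Ly) mB B1).
rewrite (@eq_Rintegral _ _ _ _ _ (fun z : Rd => (v (z + x) - v (z + y)) * \1_B z)); last first.
  by move=> z _; rewrite mulrBl.
have Lw : L1 (fun z : Rd => v (z + x) - v (z + y)) by exact: (L1B Lx Ly).
rewrite (le_trans (Rintegral_le_norm Lw mB B1))// mul1r.
rewrite -lee_fin (L1_Rintegral Lw); apply: le_trans (vC (x - y)).
have Lq : L1 (fun z : Rd => v (z + (x - y)) - v z) by exact: (L1B (L1_translate _ Lv) Lv).
rewrite -(ge0_integral_translate y (f := fun z : Rd => (`|v (z + (x - y)) - v z|)%:E))//.
  rewrite le_eqVlt; apply/orP; left; apply/eqP/eq_integral => z _.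
  by rewrite -addrA [y + _]addrC subrK.
by apply/measurable_EFinP; apply: measurableT_comp => //; case: Lq.
Qed.

(** By Tonelli the error is at most the integral over [z] in the cube of the L^1 distance between
    [v] and its translate by [z], which is at most [C e]; the cube has volume [c]. *)
Lemma averaging_close v C : L1 v -> 0 <= C ->
  (forall z, (\int[leb]_x (`|v (x + z) - v x|)%:E <= (C * `|z|)%:E)%E) ->
  measurable_fun setT (averaging v) ->
  (\int[leb]_x (`|c * v x - averaging v x|)%:E <= (C * e * c)%:E)%E.
Proof.
move=> Lv C0 vC mA; have [mv _] := Lv.
pose f (p : Rd * Rd) : \bar R := (`|v (p.2 + p.1) - v p.1| * \1_B p.2)%:E.
have f0 p : (0 <= f p)%E by rewrite lee_fin mulr_ge0.
have mf : measurable_fun setT f.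
  apply/measurable_EFinP; apply: measurable_funM.
    apply: measurableT_comp => //; apply: measurable_funB.
      apply: (measurableT_comp mv); apply: measurable_rVP => i.
      rewrite (_ : (fun _ => _) = (fun p : Rd * Rd => p.2 ord0 i + p.1 ord0 i)).
        apply: measurable_funD.
          exact: (measurableT_comp (measurable_rV_coord i) measurable_snd).
        exact: (measurableT_comp (measurable_rV_coord i) measurable_fst).
      by apply/funext => p; rewrite mxE.
    exact: (measurableT_comp mv).
  exact: (measurableT_comp mB).
have step1 x : ((`|c * v x - averaging v x|)%:E <= \int[leb]_z f (x, z))%E.
  have Lx := L1_translate x Lv.
  have i1 : leb.-integrable setT (fun z => (v x * \1_B z)%:E).
    rewrite (_ : (fun _ => _) = (fun z => (v x)%:E * (EFin \o (\1_B : Rd -> R)) z)%E).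
      exact: integrableZl.
    by apply/funext => z /=; rewrite EFinM.
  have i2 := integrable_mulr_bounded ((L1P _).1 Lx) mB B1.
  have -> : c * v x = \int[leb]_z (v x * \1_B z).
    rewrite RintegralZl// mulrC; congr (_ * _).
    by rewrite /c /Rintegral integral_indic ?setIT//; exact: measurable_cube.
  rewrite /averaging distrC -RintegralB//.
  have i12 : leb.-integrable setT (EFin \o (fun z : Rd => v (z + x) * \1_B z - v x * \1_B z)).
    rewrite (_ : EFin \o _ = (fun z : Rd => (v (z + x)%R * \1_B z)%:E) \- (fun z => (v x * \1_B z)%:E))%E.
      exact: integrableB.
    by apply/funext => z /=; rewrite EFinB.
  apply: (@le_trans _ _ (\int[leb]_z `|v (z + x) * \1_B z - v x * \1_B z|)%:E).
    by rewrite lee_fin; exact: le_normr_Rintegral.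
  rewrite /Rintegral fineK; last first.
    by apply: integrable_fin_num => //; exact: integrable_norm.
  rewrite le_eqVlt; apply/orP; left; apply/eqP/eq_integral => z _.
  by rewrite /f/= -mulrBl normrM (ger0_norm (x := \1_B z)).
apply: (@le_trans _ _ (\int[leb]_x \int[leb]_z f (x, z))%E).
  apply: ge0_le_integral => //.
  - apply/measurable_EFinP; apply: measurableT_comp => //; apply: measurable_funB => //.
    exact: measurable_funM.
  - exact: (measurable_fun_fubini_tonelli_F (m2 := leb) f mf f0).
rewrite (fubini_tonelli (m1 := leb) (m2 := leb) f mf f0).
apply: (@le_trans _ _ (\int[leb]_z ((C * e)%:E * (\1_B z)%:E))%E).
  apply: ge0_le_integral => //.
  - by move=> z _; apply: integral_ge0.
  - exact: (measurable_fun_fubini_tonelli_G (m1 := leb) f mf f0).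
  - apply: emeasurable_funM => //; exact/measurable_EFinP.
  - move=> z _; rewrite /f/= indicE; have [zB|zB] := boolP (z \in B); last first.
      by rewrite mule0 integral0_eq// => x _; rewrite mulr0.
    rewrite mule1 (eq_integral (fun x : Rd => (`|v (x + z) - v x|)%:E)); last first.
      by move=> x _; rewrite mulr1 (addrC z).
    apply: (le_trans (vC z)); rewrite lee_fin ler_wpM2l//.
    have : B z by rewrite inE in zB.
    by rewrite -ball_cube// -ball_normE/= sub0r normrN => /ltW.
have mBE : measurable_fun setT (fun z : Rd => (\1_B z : R)%:E) by exact/measurable_EFinP.
have Ce0 : (0 <= (C * e)%:E)%E by rewrite lee_fin mulr_ge0// ltW.
rewrite ge0_integralZl//.
rewrite integral_indic//; last exact: measurable_cube.
by rewrite setIT [X in (_ <= X)%E]EFinM cE.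
Qed.

Lemma continuous_averaging v C : L1 v -> 0 <= C ->
  (forall z, (\int[leb]_x (`|v (x + z) - v x|)%:E <= (C * `|z|)%:E)%E) ->
  continuous (averaging v).
Proof.
move=> Lv C0 vC x; apply/(@cvgrPdist_le _ _ _ (nbhs x)) => r r0.
have D0 : 0 < C + 1 by rewrite ltr_wpDl.
near=> y.
rewrite (le_trans (averaging_dist Lv vC _ _))//.
rewrite (@le_trans _ _ ((C + 1) * `|x - y|))// ?ler_wpM2r ?lerDl//.
rewrite mulrC -ler_pdivlMr//; near: y.
apply: filterS (nbhsx_ballx x (r / (C + 1)) _); last exact: divr_gt0.
by move=> y; rewrite -ball_normE/= => /ltW.
Unshelve. all: by end_near. Qed.

End averaging.

(** * Compactness by the Kolmogorov-Riesz argument *)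

Section L1_compactness.
Context {R : realType} (d : nat).
Local Notation Rd := 'rV[R]_d.
Local Notation leb := (@lebesgue_Rd R d).

Lemma measurable_abs_EFin (f : Rd -> R) :
  measurable_fun setT f -> measurable_fun setT (fun x => (`|f x|)%:E).
Proof. by move=> mf; apply/measurable_EFinP; exact: measurableT_comp. Qed.

Variables (C M : R).
Hypotheses (C0 : 0 <= C) (M0 : 0 <= M).

(** The hypotheses of the Kolmogorov-Riesz criterion: bounded mass, uniformly controlled
    translations, and a common bounded set outside which the functions vanish. *)
Definition translation_family (v : Rd -> R) : Prop :=
  [/\ L1 v, (\int[leb]_x (`|v x|)%:E <= 1)%E,
   forall z, (\int[leb]_x (`|v (x + z) - v x|)%:E <= (C * `|z|)%:E)%E &
   {ae leb, forall x, M < `|x| -> v x = 0}].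

(** Ascoli's argument along an ultrafilter: the averages are Cauchy at each point, equi-Lipschitz
    bounds spread this to a ball, and compactness makes it uniform. *)
Lemma averaging_ultra_cauchy (U : set_system nat) (v : nat -> Rd -> R) (e r : R) :
  UltraFilter U -> (forall n, translation_family (v n)) -> 0 < e -> 0 < r ->
  exists2 A, U A & forall n m, A n -> A m -> forall x, `|x| <= M ->
    `|averaging e (v n) x - averaging e (v m) x| <= r.
Proof.
move=> UU tv e0 r0.
have a1 n x : `|averaging e (v n) x| <= 1.
  have [Lv v1 _ _] := tv n.
  by rewrite (le_trans (averaging_le _ _ Lv))// -lee_fin L1_Rintegral.
have cK : compact [set x : Rd | `|x| <= M].
  apply: bounded_closed_compact.
    exists M; split; first exact: num_real.
    by move=> s Ms x /= xM; rewrite (le_trans xM)// ltW.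
  apply: (closed_comp _ (@closed_le _ M)) => x _.
  exact: norm_continuous.
have r30 : 0 < r / 3 by rewrite divr_gt0.
have C10 : 0 < C + 1 by rewrite ltr_wpDl.
have := (compact_near_coveringP _).1 cK (nat * nat)%type (filter_prod U U)
  (fun nm x => `|averaging e (v nm.1) x - averaging e (v nm.2) x| <= r) _.
case=> [x _|[A B] [/= UA UB] AB].
  have [A UA hA] := ultra_bounded_cauchy UU (fun n => a1 n x) r30.
  (* On this ball each average varies by at most [r/3]; using [C + 1] avoids dividing by zero. *)
  exists (ball x (r / 3 / (C + 1)), A `*` A).
    split; first by apply: nbhsx_ballx; rewrite divr_gt0.
    by exists (A, A).
  move=> [y [n m]] [/= xy [An Am]].
  have close k : `|averaging e (v k) y - averaging e (v k) x| <= r / 3.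
    have [Lv _ vC _] := tv k.
    rewrite (le_trans (averaging_dist e Lv vC _ _))//.
    rewrite (@le_trans _ _ ((C + 1) * `|y - x|))// ?ler_wpM2r ?lerDl//.
    move: xy; rewrite -ball_normE/= distrC ltr_pdivlMr// [_ * (C + 1)]mulrC.
    exact: ltW.
  have -> : averaging e (v n) y - averaging e (v m) y =
     (averaging e (v n) y - averaging e (v n) x) +
     (averaging e (v n) x - averaging e (v m) x) +
     - (averaging e (v m) y - averaging e (v m) x) by ring.
  rewrite (le_trans (ler_normD _ _))// normrN.
  have -> : r = r / 3 + r / 3 + r / 3 by field.
  rewrite lerD// (le_trans (ler_normD _ _))// lerD//.
  exact: hA.
exists (A `&` B); first exact: filterI.
by move=> n m [An _] [_ Bm] x xM; exact: (AB (n, m)).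
Qed.

Lemma ultra_L1_cauchy (U : set_system nat) (v : nat -> Rd -> R) (r : R) :
  UltraFilter U -> (forall n, translation_family (v n)) -> 0 < r ->
  exists2 A, U A & forall n m, A n -> A m ->
    (\int[leb]_x (`|v n x - v m x|)%:E <= r%:E)%E.
Proof.
move=> UU tv r0.
have C10 : 0 < C + 1 by rewrite ltr_wpDl.
(* With this [e], replacing [c v] by its average costs at most [c r/4], once for [n] and once for
   [m]. *)
pose e := r / (4 * (C + 1)).
have e0 : 0 < e by rewrite divr_gt0// mulr_gt0.
have Ce : C * e <= r / 4.
  have -> : C * e = C / (C + 1) * (r / 4) by rewrite /e; field; rewrite gt_eqF.
  by rewrite ler_piMl ?divr_ge0 ?(ltW r0)// ler_pdivrMr// mul1r lerDl.
(* The cube is open, hence the margin 1 to contain all points of norm at most [M]. *)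
pose K := cube (0 : Rd) (M + 1).
have M10 : 0 < M + 1 by rewrite ltr_wpDl.
pose c := fine (leb (cube (0 : Rd) e)).
pose L := fine (leb K).
have LE : L%:E = leb K.
  by rewrite /L fineK// ge0_fin_numE ?measure_ge0//; exact: lebesgue_Rd_cube_lty.
have L0 : 0 < L by rewrite -lte_fin LE; exact: lebesgue_Rd_cube_gt0.
have c0 : 0 < c.
  rewrite -lte_fin /c fineK; first exact: lebesgue_Rd_cube_gt0.
  by rewrite ge0_fin_numE ?measure_ge0//; exact: lebesgue_Rd_cube_lty.
(* Integrated over [K], of volume [L], a uniform error [s] costs [c r/2], which completes the total
   [c r]. *)
pose s := c * r / (2 * L).
have s0 : 0 < s by rewrite divr_gt0 ?mulr_gt0.
have [A UA hA] := averaging_ultra_cauchy UU tv e0 s0.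
exists A => // n m An Am.
have mv k : measurable_fun setT (v k) by have [[]] := tv k.
have mav k : measurable_fun setT (averaging e (v k)).
  have [Lv _ vC _] := tv k.
  exact: (continuous_measurable_rV (continuous_averaging Lv C0 vC)).
have mK : measurable K by exact: measurable_cube.
pose D k x := `|c * v k x - averaging e (v k) x|.
have mD k : measurable_fun setT (fun x => (D k x)%:E).
  by apply: measurable_abs_EFin; apply: measurable_funB => //; exact: measurable_funM.
have iD k : (\int[leb]_x (D k x)%:E <= (r / 4 * c)%:E)%E.
  have [Lv _ vC _] := tv k.
  apply: (le_trans (averaging_close e0 Lv C0 vC (mav k))).
  by rewrite lee_fin ler_wpM2r// ltW.
have mS : measurable_fun setT (fun x : Rd => (s * \1_K x)%:E).
  by apply/measurable_EFinP/measurable_funM => //; exact/measurable_indic.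
have mnm : measurable_fun setT (fun x => (`|v n x - v m x|)%:E).
  by apply: measurable_abs_EFin; exact: measurable_funB.
have D0 k x : (0 <= (D k x)%:E)%E by rewrite lee_fin normr_ge0.
have s10 (x : Rd) : (0 <= (s * \1_K x)%:E)%E by rewrite lee_fin mulr_ge0// ltW.
have main : (\int[leb]_x (c%:E * (`|v n x - v m x|)%:E) <=
    \int[leb]_x ((D n x)%:E + (D m x)%:E + (s * \1_K x)%:E))%E.
  apply: ae_ge0_le_integral => //.
  - by move=> x _; rewrite lee_fin mulr_ge0// ltW.
  - exact: measurable_funeM.
  - by move=> x _; rewrite !adde_ge0.
  - by do 2 apply: emeasurable_funD => //.
  have [_ _ _ sn] := tv n; have [_ _ _ sm] := tv m.
  apply: filterS2 sn sm => x xn xm _.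
  rewrite -EFinM -!EFinD lee_fin.
  (* The averages are Cauchy only on the ball of radius [M]; outside it both functions vanish
     a.e. *)
  have [xM|xM] := leP `|x| M; last first.
    rewrite xn// xm// subrr normr0 mulr0 !addr_ge0 ?normr_ge0//.
    by rewrite mulr_ge0// ltW.
  have -> : \1_K x = 1 :> R.
    rewrite indicE mem_set//= => i; rewrite mxE subr0.
    by rewrite (le_lt_trans (ler_coord_norm _ _))// (le_lt_trans xM)// ltrDl.
  rewrite mulr1 -{1}(gtr0_norm c0) -normrM mulrBr.
  have -> : c * v n x - c * v m x = (c * v n x - averaging e (v n) x) -
     (c * v m x - averaging e (v m) x) + (averaging e (v n) x - averaging e (v m) x).
    by ring.
  rewrite (le_trans (ler_normD _ _))// lerD//; last exact: hA.
  by rewrite (le_trans (ler_normB _ _)).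
move: main; rewrite ge0_integralZl_EFin//; last exact: ltW.
rewrite ge0_integralD//; last 2 first.
- by move=> x _; rewrite adde_ge0.
- exact: emeasurable_funD.
rewrite ge0_integralD//.
have -> : (\int[leb]_x (s * \1_K x)%:E = (c * r / 2)%:E)%E.
  rewrite (eq_integral (fun x => s%:E * (\1_K x)%:E)%E)//.
  rewrite ge0_integralZl_EFin//; last exact: ltW.
    rewrite integral_indic// setIT -[X in (_ * X)%E]/(leb K) -LE -EFinM; congr EFin.
    by rewrite /s; field; rewrite gt_eqF.
  exact/measurable_EFinP/measurable_indic.
move=> h; rewrite -(@lee_pmul2l _ c%:E)// ?lte_fin//.
apply: (le_trans h).
rewrite (_ : (c%:E * r%:E)%E = ((r / 4 * c)%:E + (r / 4 * c)%:E + (c * r / 2)%:E)%E).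
  by apply: leeD => //; exact: leeD.
by rewrite -!EFinM -!EFinD; congr EFin; field.
Qed.

(** The index [s k] is taken in the finitely many Cauchy sets of levels [j <= k] for all components.
    For [k <= l] both [s k] and [s l] then lie in the sets of level [k]. The ultrafilter contains
    the cofinite sets, whence [k <= s k]. *)
Lemma L1_compact (N : nat) (v : nat -> 'I_N -> Rd -> R) :
  (forall n i, translation_family (v n i)) ->
  exists (s : nat -> nat) (g : 'I_N -> Rd -> R), (forall k, (k <= s k)%N) /\
   forall i, [/\ measurable_fun setT (g i),
     {ae leb, forall x, v (s k) i x @[k --> \oo] --> g i x} &
     forall k, (\int[leb]_x (`|v (s k) i x - g i x|)%:E <= (1 / (2 ^ (k + 1))%:R)%:E)%E].
Proof.
move=> tv.
have [U [UU oU]] := @ultraFilterLemma nat \oo _.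
have ek0 k : 0 < 1 / (2 ^ (k + 1))%:R :> R by rewrite divr_gt0// ltr0n expn_gt0.
have /choice[A hA] (ki : nat * 'I_N) : exists A, U A /\ forall n m, A n -> A m ->
    (\int[leb]_x (`|v n ki.2 x - v m ki.2 x|)%:E <= (1 / (2 ^ (ki.1 + 1))%:R)%:E)%E.
  have [A UA h] := ultra_L1_cauchy UU (fun n => tv n ki.2) (ek0 ki.1).
  by exists A.
have /choice[s hs] (k : nat) : exists n, (k <= n)%N /\ forall j i, (j <= k)%N -> A (j, i) n.
  have : U [set n | (k <= n)%N /\ forall j i, (j <= k)%N -> A (j, i) n].
    apply: filterI; first by apply: oU; exact: nbhs_infty_ge.
    have : U [set n | forall ji : 'I_k.+1 * 'I_N, A (val ji.1, ji.2) n].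
      by apply: filter_forall => ji; have [] := hA (val ji.1, ji.2).
    apply: filterS => n h j i jk; have jk' : (j < k.+1)%N by [].
    exact: (h (Ordinal jk', i)).
  by move=> /filter_ex[n hn]; exists n.
have /choice[g hg] (i : 'I_N) : exists g : Rd -> R, [/\ measurable_fun setT g,
     {ae leb, forall x, v (s k) i x @[k --> \oo] --> g x} &
     forall k, (\int[leb]_x (`|v (s k) i x - g x|)%:E <= (1 / (2 ^ (k + 1))%:R)%:E)%E].
  apply: (@L1_limit_of_fast_cauchy _ _ _ leb (fun k => v (s k) i)).
    by move=> n; have [[]] := tv (s n) i.
  move=> k l kl; have [_ h] := hA (k, i).
  by apply: h; [exact: (hs l).2|exact: (hs k).2].
by exists s, g; split => // k; have [] := hs k.
Qed.

End L1_compactness.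

(** * Existence of competitors *)

Section tent.
Context {R : realType} (d : nat).
Local Notation Rd := 'rV[R]_d.
Local Notation leb := (@lebesgue_Rd R d).

(** Being 1-Lipschitz and zero outside a cube gives the translation bound directly, without
    computing a perimeter. *)
Definition tent (c : Rd) (r : R) (x : Rd) : R := Num.max 0 (r - `|x - c|).

Variables (c : Rd) (r : R).
Hypothesis r0 : 0 < r.
Local Notation B := (cube c r).

Let mB : measurable B. Proof. exact: measurable_cube. Qed.

Let cube_norm s x : 0 < s -> cube c s x <-> `|x - c| < s.
Proof. by move=> s0; rewrite -ball_cube// -ball_normE/= distrC. Qed.

Lemma tent_ge0 x : 0 <= tent c r x.
Proof. by rewrite /tent le_max lexx. Qed.

Lemma tent_le x : tent c r x <= r * \1_B x.
Proof.
rewrite /tent ge_max mulr_ge0 ?(ltW r0)//=; have [xB|xB] := pselect (B x).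
  by rewrite indicE mem_set// mulr1 gerBl.
by rewrite indicE memNset// mulr0 subr_le0 leNgt; apply/negP => /(cube_norm _ r0).
Qed.

Lemma tent_eq0 x : r <= `|x - c| -> tent c r x = 0.
Proof. by move=> h; rewrite /tent max_l// subr_le0. Qed.

Lemma tent_lipschitz x y : `|tent c r x - tent c r y| <= `|x - y|.
Proof.
have h (a b : R) : `|Num.max 0 a - Num.max 0 b| <= `|a - b|.
  by rewrite ler_norml; have := ler_norm (a - b); have := ler_norm (- (a - b));
    rewrite normrN; case: (leP 0 a); case: (leP 0 b) => *; apply/andP; split; lra.
rewrite (le_trans (h _ _))//.
have -> : r - `|x - c| - (r - `|y - c|) = `|y - c| - `|x - c| by ring.
by rewrite (le_trans (ler_dist_dist _ _))// opprB addrA subrK distrC.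
Qed.

Lemma measurable_tent : measurable_fun setT (tent c r).
Proof.
apply: continuous_measurable_rV => x; apply/(@cvgrPdist_le _ _ _ (nbhs x)) => e e0.
apply: filterS (nbhsx_ballx x e e0) => y.
by rewrite -ball_normE/= => /ltW; exact: le_trans (tent_lipschitz _ _).
Qed.

Lemma integral_cube (s t : R) : 0 < t ->
  (\int[leb]_x (s * \1_(cube c t) x)%:E = s%:E * leb (cube c t))%E.
Proof.
move=> t0; have mt : measurable (cube c t) by exact: measurable_cube.
rewrite (eq_integral (fun x => s%:E * (\1_(cube c t) x)%:E)%E)//.
rewrite integralZl//; first by rewrite integral_indic// setIT.
apply/integrableP; split; first exact/measurable_EFinP/measurable_indic.
rewrite (eq_integral (fun x => (\1_(cube c t) x)%:E)); last first.
  by move=> x _ /=; rewrite ger0_norm.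
by rewrite integral_indic// setIT; exact: lebesgue_Rd_cube_lty.
Qed.

Lemma integral_tent_lty : (\int[leb]_x (`|tent c r x|)%:E < +oo)%E.
Proof.
apply: (@le_lt_trans _ _ (\int[leb]_x (r * \1_B x)%:E)%E).
  apply: ge0_le_integral => //.
  - by apply: measurable_abs_EFin; exact: measurable_tent.
  - by apply/measurable_EFinP/measurable_funM => //; exact: measurable_indic.
  - by move=> x _; rewrite lee_fin ger0_norm ?tent_ge0// tent_le.
rewrite integral_cube// lte_mul_pinfty ?lee_fin ?ltW//.
exact: lebesgue_Rd_cube_lty.
Qed.

Lemma integral_tent_gt0 : (0 < \int[leb]_x (`|tent c r x|)%:E)%E.
Proof.
have r20 : 0 < r / 2 by rewrite divr_gt0.
apply: (@lt_le_trans _ _ (\int[leb]_x (r / 2 * \1_(cube c (r / 2)) x)%:E)%E).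
  by rewrite integral_cube// mule_gt0 ?lte_fin//; exact: lebesgue_Rd_cube_gt0.
apply: ge0_le_integral => //.
- by move=> x _; rewrite lee_fin mulr_ge0// ltW.
- apply/measurable_EFinP/measurable_funM => //; apply: measurable_indic.
  exact: measurable_cube.
- by apply: measurable_abs_EFin; exact: measurable_tent.
- move=> x _; rewrite lee_fin ger0_norm ?tent_ge0//.
  have [xB|xB] := pselect (cube c (r / 2) x); last first.
    by rewrite indicE memNset// mulr0 tent_ge0.
  rewrite indicE mem_set// mulr1 /tent le_max; apply/orP; right.
  by move/(cube_norm _ r20) : xB => h; lra.
Qed.

Lemma norm_basis_vec (i : 'I_d) : `|basis_vec i : Rd| <= 1.
Proof.
rewrite [leLHS]/Num.Def.normr/= mx_normrE.
apply/bigmax_leP; split => // -[k j] _ /=; rewrite mxE.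
by case: (_ && _); rewrite ?normr1 ?normr0.
Qed.

(** An increment of the tent under a shift of size at most [|t|] is at most [|t|], and it vanishes
    unless one of the two points lies in the cube. Two cubes of volume [L] give the constant
    [k (L + L)]. *)
Lemma BV_tent (k : R) : 0 <= k -> BV (fun x => k * tent c r x).
Proof.
move=> k0; have mt := measurable_tent.
have Lt : L1 (fun x => k * tent c r x).
  split; first exact: measurable_funM.
  rewrite (eq_integral (fun x => k%:E * (`|tent c r x|)%:E)%E); last first.
    by move=> x _; rewrite normrM (ger0_norm k0).
  rewrite ge0_integralZl_EFin//; last exact: measurable_abs_EFin.
  by rewrite lte_mul_pinfty ?lee_fin//; exact: integral_tent_lty.
split => //.
have [L LE] : exists L : R, L%:E = leb B.
  exists (fine (leb B)); rewrite fineK// ge0_fin_numE ?measure_ge0//.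
  exact: lebesgue_Rd_cube_lty.
apply: (@le_lt_trans _ _ (d%:R * (k * (L + L)))%:E); last exact: ltry.
apply: (@total_variation_le_of_translate _ _ _ (k * (L + L)) Lt) => i t.
have m1 : measurable_fun setT (fun x : Rd => (k * `|t| * \1_B x)%:E).
  by apply/measurable_EFinP/measurable_funM => //; exact: measurable_indic.
have m2 : measurable_fun setT (fun x : Rd => (k * `|t| * \1_B (x + t *: basis_vec i))%:E).
  exact: (measurable_fun_translate_e (t *: basis_vec i) m1).
have p1 (x : Rd) : (0 <= (k * `|t| * \1_B x)%:E)%E by rewrite lee_fin !mulr_ge0.
have E : (\int[leb]_x ((k * `|t| * \1_B x)%:E) = (k * `|t| * L)%:E)%E.
  by rewrite integral_cube// -LE.
have -> : ((k * (L + L) * `|t|)%:E = \int[leb]_x ((k * `|t| * \1_B x)%:E) +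
   \int[leb]_x ((k * `|t| * \1_B (x + t *: basis_vec i)%R)%:E))%E.
  rewrite (ge0_integral_translate (t *: basis_vec i) m1 p1) E -EFinD; congr EFin.
  by ring.
rewrite -ge0_integralD//.
apply: ge0_le_integral => //.
- apply: measurable_abs_EFin; apply: measurable_funB; apply: measurable_funM => //.
  exact: measurable_fun_translate.
- exact: emeasurable_funD.
- move=> x _; rewrite -EFinD lee_fin -mulrBr normrM (ger0_norm k0) -!mulrA -mulrDr.
  rewrite ler_wpM2l// -mulrDr.
  set y := x + _; have tl : `|tent c r y - tent c r x| <= `|t|.
    rewrite (le_trans (tent_lipschitz _ _))// /y [x + _]addrC addrK normrZ.
    by rewrite ler_piMr// norm_basis_vec.
  have tz z : ~ B z -> tent c r z = 0.
    move=> nB; apply: tent_eq0; rewrite leNgt; apply/negP => /(cube_norm _ r0).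
    exact: nB.
  rewrite !indicE; have [yB|yB] := pselect (B y).
    by rewrite (mem_set yB) (le_trans tl)// ler_peMr// lerDr.
  have [xB|xB] := pselect (B x).
    by rewrite (mem_set xB) (le_trans tl)// ler_peMr// lerDl.
  by rewrite !tz// subrr normr0 mulr_ge0.
Qed.

End tent.

Section competitor.
Context {R : realType} (d N : nat).
Local Notation Rd := 'rV[R]_d.
Local Notation leb := (@lebesgue_Rd R d).

(** Normalized tents are placed side by side along one axis inside a ball contained in [Omega];
    positivity of [d] provides the axis. *)
Lemma oneN_function_exists (Omega : set Rd) : (0 < d)%N -> Omega !=set0 ->
  open Omega -> exists u : 'I_N -> Rd -> R, oneN_function Omega u.
Proof.
move=> d0 [x0 Ox0] oO; pose i0 : 'I_d := Ordinal d0.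
have /nbhs_ballP[r /= r0 rO] := open_nbhs_nbhs (conj oO Ox0).
(* Centres are [h] apart and radii are [h/2], so the tents are disjoint; a point of a tent is within
   [h N + h/2 < r] of [x0]. *)
pose h := r / N.+1%:R.
have h0 : 0 < h by rewrite divr_gt0.
have h20 : 0 < h / 2 by rewrite divr_gt0.
pose c (i : 'I_N) : Rd := x0 + (h * i%:R) *: basis_vec i0.
pose t i := tent (c i) (h / 2).
have tz i x : t i x != 0 -> `|x - c i| < h / 2.
  by move=> tx; rewrite ltNge; apply: contra_neqN tx => /tent_eq0; apply.
pose I i := fine (\int[leb]_x (`|t i x|)%:E).
have IE i : ((I i)%:E = \int[leb]_x (`|t i x|)%:E)%E.
  rewrite /I fineK// ge0_fin_numE; first exact: integral_tent_lty.
  by apply: integral_ge0.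
have I0 i : 0 < I i by rewrite -lte_fin IE; exact: integral_tent_gt0.
have Iv0 i : 0 <= (I i)^-1 by rewrite invr_ge0 ltW.
exists (fun i x => (I i)^-1 * t i x); split.
- move=> i; split; first exact: BV_tent.
  apply/aeW => x nO; have [tx|/tz xc] := eqVneq (t i x) 0; first by rewrite tx mulr0.
  exfalso; apply: nO; apply: rO; rewrite -ball_normE/= distrC.
  have -> : x - x0 = (x - c i) + (h * i%:R) *: basis_vec i0.
    by rewrite /c opprD addrA subrK.
  rewrite (le_lt_trans (ler_normD _ _))//.
  have : `|(h * i%:R) *: (basis_vec i0 : Rd)| <= h * i%:R.
    have hi : 0 <= h * i%:R by rewrite mulr_ge0// ltW.
    by rewrite normrZ (ger0_norm hi) ler_piMr// norm_basis_vec.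
  have : h * i%:R <= h * N%:R by rewrite (ler_wpM2l (ltW h0))// ler_nat ltnW.
  have : r = h * N%:R + h by rewrite /h -natr1; field; rewrite natr1.
  move: xc => /=; lra.
- by move=> i; apply/aeW => x; rewrite mulr_ge0// tent_ge0.
- move=> i; rewrite (eq_integral (fun x => (I i)^-1%:E * (`|t i x|)%:E)%E); last first.
    by move=> x _; rewrite normrM (ger0_norm (Iv0 i)).
  rewrite ge0_integralZl_EFin//; last first.
    by apply: measurable_abs_EFin; exact: measurable_tent.
  by rewrite -IE -EFinM mulVf// gt_eqF.
- move=> i j ij; apply/aeW => x.
  (* Stated for variables: unification of [t j x] with 0 would unfold the integrals. *)
  have aux (a1 a2 b1 b2 : R) : a2 = 0 \/ b2 = 0 -> a1 * a2 * (b1 * b2) = 0.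
    by case=> ->; rewrite !mulr0 ?mul0r.
  apply: aux.
  have [tix|/tz xi] := eqVneq (t i x) 0; first by left.
  have [tjx|/tz xj] := eqVneq (t j x) 0; first by right.
  exfalso.
  have cij : `|c i - c j| < h.
    have -> : c i - c j = (x - c j) - (x - c i) by rewrite opprB [RHS]addrC addrA subrK.
    by rewrite (le_lt_trans (ler_normB _ _))// (splitr h) addrC ltrD.
  have := le_lt_trans (ler_coord_norm (c i - c j) i0) cij.
  rewrite !mxE !eqxx /= !mulr1 opprD addrACA subrr add0r -mulrBr normrM gtr0_norm//.
  rewrite gtr_pMr// ltNge => /negP; apply.
  have : (i : nat) != j by [].
  rewrite neq_ltn => /orP[ltij|ltij].
    rewrite distrC ler_normr; apply/orP; left.
    by rewrite lerBrDr addrC natr1 ler_nat.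
  by rewrite ler_normr lerBrDr addrC natr1 ler_nat ltij.
Qed.

End competitor.

(** * Passing to the limit *)

Section L1_limits.
Context {R : realType} (d : nat).
Local Notation Rd := 'rV[R]_d.
Local Notation leb := (@lebesgue_Rd R d).

Lemma cvg_half_pow : (1 / (2 ^ (k + 1))%:R : R) @[k --> \oo] --> (0 : R).
Proof.
rewrite (_ : (fun _ => _) = geometric (1 / 2) (1 / 2)).
  by apply: cvg_geometric; rewrite ger0_norm//; lra.
by apply/funext => k; rewrite /= addn1 expnS natrM natrX !div1r invfM exprVn.
Qed.

Lemma near_half_pow_le (e : R) : 0 < e ->
  \forall k \near \oo, (1 / (2 ^ (k + 1))%:R : R) <= e.
Proof.
move=> e0; have /cvgrPdist_le/(_ _ e0) := cvg_half_pow.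
apply: filterS => k; rewrite sub0r normrN; exact: le_trans (ler_norm _).
Qed.

Variables (v : nat -> Rd -> R) (g : Rd -> R).
Hypotheses (Lv : forall k, L1 (v k)) (mg : measurable_fun setT g).
Hypothesis vg : forall k,
  (\int[leb]_x (`|v k x - g x|)%:E <= (1 / (2 ^ (k + 1))%:R)%:E)%E.

Let Lvg k : L1 (v k - g).
Proof.
split; first by apply: measurable_funB => //; case: (Lv k).
exact: le_lt_trans (vg k) (ltry _).
Qed.

Lemma L1_limit : L1 g.
Proof.
have -> : g = v 0%N - (v 0%N - g) by rewrite opprB addrC subrK.
exact: (L1B (Lv 0%N) (Lvg 0%N)).
Qed.

Lemma norm_L1_limit (a : R) : (forall k, (\int[leb]_x (`|v k x|)%:E = a%:E)%E) ->
  (\int[leb]_x (`|g x|)%:E = a%:E)%E.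
Proof.
move=> va.
have mv k : measurable_fun setT (v k) by case: (Lv k).
have mvg k : measurable_fun setT (fun x => (`|v k x - g x|)%:E).
  by apply: measurable_abs_EFin; exact: measurable_funB.
have mgE := measurable_abs_EFin mg.
have mvE k := measurable_abs_EFin (mv k).
apply/eqP; rewrite eq_le; apply/andP; split; apply/lee_addgt0Pr => e e0.
  near \oo => k.
  apply: (@le_trans _ _ (\int[leb]_x ((`|v k x|)%:E + (`|v k x - g x|)%:E))%E).
    apply: ge0_le_integral => //; first exact: emeasurable_funD.
    move=> x _; rewrite -EFinD lee_fin -[leRHS]addrC -lerBlDr.
    by rewrite distrC; exact: lerB_dist.
  rewrite ge0_integralD// va leeD2l//.
  by rewrite (le_trans (vg k))// lee_fin; near: k; exact: near_half_pow_le.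
near \oo => k; rewrite -(va k).
apply: (@le_trans _ _ (\int[leb]_x ((`|g x|)%:E + (`|v k x - g x|)%:E))%E).
  apply: ge0_le_integral => //; first exact: emeasurable_funD.
  by move=> x _; rewrite -EFinD lee_fin -[leRHS]addrC -lerBlDr; exact: lerB_dist.
rewrite ge0_integralD// leeD2l//.
by rewrite (le_trans (vg k))// lee_fin; near: k; exact: near_half_pow_le.
Unshelve. all: by end_near. Qed.

Lemma divergence_bounded phi : test_field phi ->
  continuous (divergence phi) /\
  exists2 K : R, 0 <= K & forall x : Rd, `|divergence phi x| <= K.
Proof.
move=> [dphi Dphi cphi _].
have /bounded_supportP[M hM] := cphi.
have cD : continuous (divergence phi).
  rewrite (_ : divergence phi =
      \sum_(i < d) (fun x => 'D_(basis_vec i) (fun y => phi y ord0 i) x)); last first.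
    by apply/funext => x; rewrite fct_sumE.
  elim/big_ind : _ => [|f h cf ch|i _]; first exact: cst_continuous.
    by move=> x; apply: continuousD; [exact: cf|exact: ch].
  exact: Dphi.
split => //; apply: bounded_of_bounded_support => //.
exists M => x Mx; rewrite /divergence big1// => i _.
by apply: (derive_eq0_outside (M := M)) => // y /hM ->; rewrite mxE.
Qed.

(** For a fixed test field the integral is L^1-continuous in the function, because the divergence is
    bounded; a supremum of such functionals is lower semicontinuous. This form also allows an
    infinite total variation of [g]. *)
Lemma total_variation_lsc (a : \bar R) : (a < total_variation g)%E ->
  \forall k \near \oo, (a < total_variation (v k))%E.
Proof.
move=> /ereal_sup_gt[_ [phi tphi <-] aphi].
have [cD [K K0 DK]] := divergence_bounded tphi.
have mD := continuous_measurable_rV cD.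
have iv k := integrable_mulr_bounded ((L1P _).1 (Lv k)) mD DK.
have ig := integrable_mulr_bounded ((L1P _).1 L1_limit) mD DK.
have fE : ((\int[leb]_x (g x * divergence phi x))%:E =
  \int[leb]_x (g x * divergence phi x)%:E)%E.
  by rewrite /Rintegral fineK//; exact: integrable_fin_num.
have fkE k : ((\int[leb]_x (v k x * divergence phi x))%:E =
  \int[leb]_x (v k x * divergence phi x)%:E)%E.
  by rewrite /Rintegral fineK//; exact: integrable_fin_num.
pose I := \int[leb]_x (g x * divergence phi x).
have hk k : `|\int[leb]_x (v k x * divergence phi x) - I| <= K * (1 / (2 ^ (k + 1))%:R).
  rewrite /I -(RintegralB measurableT (iv k) ig).
  rewrite (@eq_Rintegral _ _ _ _ _ (fun x => (v k - g) x * divergence phi x)); last first.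
    by move=> x _; rewrite -mulrBl.
  rewrite (le_trans (Rintegral_le_norm (Lvg k) mD DK))// ler_wpM2l//.
  by rewrite -lee_fin (L1_Rintegral (Lvg k)); exact: vg.
(* A real [b] stands in for [a], which may be [-oo]. *)
have [b ab bphi] : exists2 b : R, (a <= b%:E)%E & b < I.
  move: aphi; rewrite -fE; case: a => [a| |] //=.
    by rewrite lte_fin => h; exists a.
  by move=> _; exists (I - 1); rewrite ?leNye// gtrBl.
(* An L^1 distance of this size changes the integral by at most half of the gap [I - b]. *)
have e0 : 0 < (I - b) / (2 * (K + 1)).
  by rewrite divr_gt0 ?subr_gt0// mulr_gt0// ltr_wpDl.
apply: filterS (near_half_pow_le e0) => k h2.
apply: (le_lt_trans ab); apply: lt_le_trans (integral_divergence_le (v k) tphi).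
rewrite -fkE lte_fin.
have := hk k; rewrite ler_norml => /andP[h _].
have h3 : K * (1 / (2 ^ (k + 1))%:R) <= (I - b) / 2.
  apply: (le_trans (ler_wpM2l K0 h2)).
  have -> : K * ((I - b) / (2 * (K + 1))) = K / (K + 1) * ((I - b) / 2).
    by field; rewrite gt_eqF// ltr_wpDl.
  rewrite ler_piMl ?divr_ge0 ?subr_ge0 ?(ltW bphi)//.
  by rewrite ler_pdivrMr ?ltr_wpDl// mul1r lerDl.
by move: h h3 bphi; set J := \int[leb]_x _; lra.
Qed.

End L1_limits.

(** * The minimizer *)

Section eigenfunction.
Context {R : realType} (d N : nat).
Local Notation Rd := 'rV[R]_d.
Local Notation leb := (@lebesgue_Rd R d).

Lemma fine_total_variation (u : Rd -> R) : (total_variation u < +oo)%E ->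
  ((fine (total_variation u))%:E = total_variation u)%E.
Proof. by move=> h; rewrite fineK// ge0_fin_numE// total_variation_nonneg. Qed.

Lemma bracket1_nonneg (u : 'I_N -> Rd -> R) : nonneg_vec (bracket1 u).
Proof. by move=> i; rewrite mxE fine_ge0// total_variation_nonneg. Qed.

(** The factor [d] comes from bounding the sum of the coordinates of [z] by [d] times its sup
    norm. *)
Lemma translation_family_oneN (Omega : set Rd) (C M : R) (u : 'I_N -> Rd -> R) i :
  (forall x, Omega x -> `|x| <= M) -> oneN_function Omega u ->
  fine (total_variation (u i)) <= C ->
  translation_family (d%:R * C) M (u i).
Proof.
move=> OM [bv _ u1 _] uC; have [[Lu tvu] u0] := bv i; split => //.
- by rewrite u1.
- move=> z; apply: (le_trans (translate_le Lu tvu z)); rewrite lee_fin.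
  have tv0 : 0 <= fine (total_variation (u i)).
    by rewrite fine_ge0// total_variation_nonneg.
  have s0 : 0 <= \sum_j `|z ord0 j| by exact: sumr_ge0.
  by rewrite (le_trans (ler_pM tv0 s0 uC (sum_coord_le z)))// mulrA (mulrC C).
- apply: filterS u0 => x h Mx; apply: h => /OM.
  by rewrite leNgt Mx.
Qed.

(** Sign, vanishing outside [Omega] and disjointness pass to the pointwise limit off a countable
    union of null sets; the mass passes by L^1 convergence, the total variation bound by lower
    semicontinuity. *)
Lemma oneN_function_limit (Omega : set Rd) (C : R) (u : nat -> 'I_N -> Rd -> R)
    (g : 'I_N -> Rd -> R) : (forall k, oneN_function Omega (u k)) ->
  (forall k i, (total_variation (u k i) <= C%:E)%E) ->
  (forall i, [/\ measurable_fun setT (g i),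
     {ae leb, forall x, u k i x @[k --> \oo] --> g i x} &
     forall k, (\int[leb]_x (`|u k i x - g i x|)%:E <= (1 / (2 ^ (k + 1))%:R)%:E)%E]) ->
  oneN_function Omega g.
Proof.
move=> ou uC ug.
have Lu k i : L1 (u k i) by have [/(_ i)[[]]] := ou k.
split.
- move=> i; have [mg cg ug1] := ug i; split.
    split; first exact: (L1_limit (fun k => Lu k i) mg ug1).
    apply: (@le_lt_trans _ _ C%:E); last exact: ltry.
    rewrite leNgt; apply/negP => h.
    have := total_variation_lsc (fun k => Lu k i) mg ug1 h.
    by move=> /filter_ex[k]; rewrite ltNge uC.
  have : {ae leb, forall x, forall k, ~ Omega x -> u k i x = 0}.
    by apply: ae_foralln => k; have [/(_ i)[]] := ou k.
  apply: filterS2 cg => x cx ux nO.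
  apply: (cvg_unique _ cx) => //.
  rewrite (_ : (fun k => u k i x) = cst 0); first exact: cvg_cst.
  by apply/funext => k; exact: ux.
- move=> i; have [mg cg ug1] := ug i.
  have : {ae leb, forall x, forall k, 0 <= u k i x}.
    by apply: ae_foralln => k; have [_ /(_ i)] := ou k.
  apply: filterS2 cg => x cx ux.
  by rewrite -(cvg_lim _ cx)//; apply: limr_ge; [apply/cvg_ex; exists (g i x)|exact: nearW].
- move=> i; have [mg cg ug1] := ug i.
  apply: (norm_L1_limit (fun k => Lu k i) mg ug1) => k.
  by have [_ _ /(_ i)] := ou k.
- move=> i j ij; have [_ ci _] := ug i; have [_ cj _] := ug j.
  have : {ae leb, forall x, forall k, u k i x * u k j x = 0}.
    by apply: ae_foralln => k; have [_ _ _ /(_ i j ij)] := ou k.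
  apply: filterS3 ci cj => x cxi cxj ux.
  apply: (cvg_unique _ (cvgM cxi cxj)) => //.
  rewrite (_ : _ \* _ = cst 0); first exact: cvg_cst.
  by apply/funext => k; exact: ux.
Qed.

End eigenfunction.

Theorem mainTheorem8 (R : realType) (d N : nat) (Omega : set 'rV[R]_d)
    (Phi : 'rV[R]_N -> R) :
  (0 < d)%N ->
  Omega !=set0 -> bounded_set Omega -> open Omega ->
  Phi_codomain Phi -> Phi1 Phi -> Phi2 Phi -> Phi3 Phi ->
  exists u : 'I_N -> 'rV[R]_d -> R, eigen_N_function Phi Omega u.
Proof.
move=> d0 On0 bO oO Phi0 Phil [delta delta0 Phid] Phim.
have [w0 ow0] := @oneN_function_exists R d N Omega d0 On0 oO.
have Lambda_le u : oneN_function Omega u -> (Lambda Phi Omega <= (Phi (bracket1 u))%:E)%E.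
  by move=> ou; apply: ereal_inf_lbound; exists u.
have Lambda_ge0 : (0 <= Lambda Phi Omega)%E.
  apply: le_ereal_inf_tmp => _ [u ou <-]; rewrite lee_fin Phi0//.
  exact: bracket1_nonneg.
have Lfin : Lambda Phi Omega \is a fin_num.
  by rewrite ge0_fin_numE// (le_lt_trans (Lambda_le _ ow0))// ltry.
pose lam := fine (Lambda Phi Omega).
have lamE : lam%:E = Lambda Phi Omega by rewrite fineK.
have lam0 : 0 <= lam by rewrite fine_ge0.
have /choice[u hu] (n : nat) : exists u, oneN_function Omega u /\
    Phi (bracket1 u) < lam + n.+1%:R^-1.
  have : (Lambda Phi Omega < (lam + n.+1%:R^-1)%:E)%E.
    by rewrite -lamE lte_fin ltrDl invr_gt0.
  by move/ereal_inf_lt => [_ [u ou <-]]; rewrite lte_fin => h; exists u.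
(* By (Phi.2), [delta] times the sum of the total variations is at most [Phi], which is below
   [lam + 1/(n+1) <= lam + 1]. *)
pose C := (lam + 1) / delta.
have uC n i : fine (total_variation (u n i)) <= C.
  have [ou Pu] := hu n; rewrite /C ler_pdivlMr// mulrC.
  have b0 := bracket1_nonneg (u n).
  have hi : fine (total_variation (u n i)) <= \sum_(j < N) bracket1 (u n) ord0 j.
    by rewrite (bigD1 i)//= mxE lerDl sumr_ge0.
  rewrite (le_trans (ler_wpM2l (ltW delta0) hi))// (le_trans (Phid _ b0))//.
  by rewrite (le_trans (ltW Pu))// lerD2l invf_le1// ler1n.
have C0 : 0 <= C by rewrite divr_ge0 ?addr_ge0 ?(ltW delta0).
have [M0 [_ hM]] := bO; pose M := `|M0| + 1.
have OM x : Omega x -> `|x| <= M.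
  by move=> Ox; apply: (hM M) => //; rewrite /M (le_lt_trans (ler_norm _))// ltrDl.
have M_ge0 : 0 <= M by rewrite /M addr_ge0.
have dC0 : 0 <= d%:R * C by rewrite mulr_ge0.
have tf n i : translation_family (d%:R * C) M (u n i).
  by have [ou _] := hu n; exact: (translation_family_oneN OM ou (uC n i)).
have [s [g [sk ug]]] := L1_compact dC0 M_ge0 tf.
have og : oneN_function Omega g.
  apply: (@oneN_function_limit _ _ _ _ C (fun k => u (s k))) => // [k|k i].
    by have [] := hu (s k).
  have [[/(_ i)[[_ tvu] _] _ _ _] _] := hu (s k).
  by rewrite -fine_total_variation// lee_fin.
exists g; split => //; apply/eqP; rewrite eq_le Lambda_le// andbT.
rewrite -lamE lee_fin leNgt; apply/negP => lamg.
(* A level strictly between the infimum and the supposedly larger value at [g]; some [u (s k)] is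
   shown to lie both below and above it. *)
pose a := (lam + Phi (bracket1 g)) / 2.
have lama : lam < a by rewrite /a; lra.
have ag : a < Phi (bracket1 g) by rewrite /a; lra.
have [V /nbhs_ballP[eta /= eta0 etaV] aV] := Phil _ (bracket1_nonneg g) _ ag.
have tvg i : (total_variation (g i) < +oo)%E by have [/(_ i)[[]]] := og.
have tvu n i : (total_variation (u n i) < +oo)%E.
  by have [[/(_ i)[[]]]] := hu n.
have near_tv : \forall k \near \oo, forall i : 'I_N,
    fine (total_variation (g i)) - eta / 2 < fine (total_variation (u (s k) i)).
  apply: filter_forall => i; have [mg cg ugi] := ug i.
  have Lui k : L1 (u (s k) i) by have [[/(_ i)[[]]]] := hu (s k).
  have h : ((fine (total_variation (g i)) - eta / 2)%:E < total_variation (g i))%E.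
    by rewrite -(fine_total_variation (tvg i)) lte_fin gtrBl divr_gt0.
  have := total_variation_lsc Lui mg ugi h; apply: filterS => k.
  by rewrite -(fine_total_variation (tvu _ _)) lte_fin.
have near_a : \forall k \near \oo, lam + k.+1%:R^-1 < a.
  have al0 : 0 < a - lam by rewrite subr_gt0.
  have /cvgrPdist_lt/(_ _ al0) := @cvg_harmonic R.
  apply: filterS => k; rewrite sub0r normrN ger0_norm /harmonic/= ?invr_ge0//.
  by rewrite ltrBrDl.
have [k [tvk ak]] := filter_ex (filterI near_tv near_a).
(* Only liminf [u (s k)]_1 >= [g]_1 holds; truncating by [g]_1 gives vectors close
   to [g]_1, where lower semicontinuity applies, and below [u (s k)]_1. *)
pose w : 'rV[R]_N := \row_i Num.min (bracket1 g ord0 i) (bracket1 (u (s k)) ord0 i).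
have w0' : nonneg_vec w.
  by move=> i; rewrite mxE le_min !bracket1_nonneg.
have : a < Phi w.
  apply: aV => //; apply: etaV; rewrite ball_cube// => i.
  rewrite !mxE; have := tvk i.
  set tg := fine _; set tu := fine _ => h.
  by case: (leP tg tu) => gu; rewrite ?subrr ?normr0// ltr0_norm ?subr_lt0//; lra.
apply/negP; rewrite -leNgt.
apply: (@le_trans _ _ (Phi (bracket1 (u (s k))))).
  apply: Phim => //; first exact: bracket1_nonneg.
  by move=> i; rewrite mxE ge_min lexx orbT.
have [_ /ltW h] := hu (s k); apply: (le_trans h); apply: ltW.
(* Here [k <= s k] bounds the excess [1/(s k + 1)] of the minimizing sequence by [1/(k + 1)]. *)
apply: le_lt_trans ak; rewrite lerD2l lef_pV2 ?posrE// ler_nat ltnS.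
exact: sk.
Qed.
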